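(* Assume that $\mathsf{IST}$ is consistent. Then there is no sentence $\Phi$ of the $\in$-language (the language of $\mathsf{ZFC}$) such that the equivalence $\Phi \leftrightarrow (\ast)$ is a theorem of $\mathsf{IST}$, where $(\ast)$ is the $\mathsf{IST}$-sentence $$\forall F\,\Big[\,\forall^{\mathrm{st}} n\,\big(F(n)\text{ is standard}\big)\;\longrightarrow\;\exists^{\mathrm{st}} G\;\forall^{\mathrm{st}} n\,\big(F(n)=G(n)\big)\Big],$$ in which $n$ ranges over natural numbers and $F,G$ range over functions defined on the natural numbers (taking arbitrary values).
   Context: $\mathsf{IST}$ (Nelson's internal set theory) is formulated in the language with $=$, $\in$ and a unary predicate $\mathrm{st}$ (''standard''). Formulas not mentioning $\mathrm{st}$ are called internal ($\in$-formulas). Abbreviations: $\exists^{\mathrm{st}}x\,\varphi$ means $\exists x(\mathrm{st}(x)\wedge\varphi)$, $\forall^{\mathrm{st}}x\,\varphi$ means $\forall x(\mathrm{st}(x)\to\varphi)$, and $\forall^{\mathrm{st\,fin}}A$ means ''for all standard finite $A$''. $\mathsf{IST}$ consists of all axioms of $\mathsf{ZFC}$ (with Separation and Replacement only for internal formulas) together with the schemes: Idealization: $\forall^{\mathrm{st\,fin}}A\,\exists x\,\forall a\in A\,\Phi(x,a)\leftrightarrow\exists x\,\forall^{\mathrm{st}}a\,\Phi(x,a)$ for every internal $\Phi$ (arbitrary parameters); Standardization: $\forall^{\mathrm{st}}X\,\exists^{\mathrm{st}}Y\,\forall^{\mathrm{st}}x\,[x\in Y\leftrightarrow x\in X\wedge\Phi(x)]$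 for every formula $\Phi$ of the $\mathsf{IST}$ language (arbitrary parameters); Transfer: $\exists x\,\Phi(x)\to\exists^{\mathrm{st}}x\,\Phi(x)$ for every internal $\Phi$ all of whose parameters are standard. *)

(* Defs.v *)
From Stdlib Require Import List Arith.
Import ListNotations.

(** * Syntax: variables are de Bruijn indices (there are no function
    symbols, so terms are variables). *)
Inductive form : Type :=
| FEq  : nat -> nat -> form
| FMem : nat -> nat -> form
| FSt  : nat -> form
| FBot : form
| FImp : form -> form -> form
| FAll : form -> form.               (* binds index 0 *)

Definition FNot p := FImp p FBot.
Definition FTop := FNot FBot.
Definition FOr p q := FImp (FNot p) q.
Definition FAnd p q := FNot (FImp p (FNot q)).
Definition FIff p q := FAnd (FImp p q) (FImp q p).
Definition FEx p := FNot (FAll (FNot p)).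

Fixpoint internal (p : form) : Prop :=
  match p with
  | FSt _ => False
  | FImp p q => internal p /\ internal q
  | FAll p => internal p
  | _ => True
  end.

Fixpoint bounded (n : nat) (p : form) : Prop :=
  match p with
  | FEq i j | FMem i j => i < n /\ j < n
  | FSt i => i < n
  | FBot => True
  | FImp p q => bounded n p /\ bounded n q
  | FAll p => bounded (S n) p
  end.

Definition upr (r : nat -> nat) (i : nat) : nat :=
  match i with 0 => 0 | S k => S (r k) end.
Fixpoint ren (r : nat -> nat) (p : form) : form :=
  match p with
  | FEq i j => FEq (r i) (r j)
  | FMem i j => FMem (r i) (r j)
  | FSt i => FSt (r i)
  | FBot => FBot
  | FImp p q => FImp (ren r p) (ren r q)
  | FAll p => FAll (ren (upr r) p)
  end.
Definition scons (t : nat) (r : nat -> nat) (i : nat) : nat :=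
  match i with 0 => t | S k => r k end.
Definition inst (t : nat) (p : form) : form := ren (scons t (fun k => k)) p.

(** * Hilbert calculus (rules: modus ponens and generalization).
    Non-closed axioms of a theory stand for their universal closures. *)
Inductive LogAx : form -> Prop :=
| LA1 p q : LogAx (FImp p (FImp q p))
| LA2 p q r : LogAx (FImp (FImp p (FImp q r)) (FImp (FImp p q) (FImp p r)))
| LA3 p : LogAx (FImp (FNot (FNot p)) p)
| LA4 p t : LogAx (FImp (FAll p) (inst t p))
| LA5 p q : LogAx (FImp (FAll (FImp p q)) (FImp (FAll p) (FAll q)))
| LA6 p : LogAx (FImp p (FAll (ren S p)))
| LA7 i : LogAx (FEq i i)
| LA8 p i j : LogAx (FImp (FEq i j) (FImp (inst i p) (inst j p))).

Inductive Prv (T : form -> Prop) : form -> Prop :=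
| PAx p : T p -> Prv T p
| PLog p : LogAx p -> Prv T p
| PMP p q : Prv T (FImp p q) -> Prv T p -> Prv T q
| PGen p : Prv T p -> Prv T (FAll p).

Definition Consistent (T : form -> Prop) : Prop := ~ Prv T FBot.

(** * Builder with named binders: a formula under construction is a
    function of the current binder depth; a bound variable is represented by
    its de Bruijn level. *)
Definition bf := nat -> form.
Definition bEq (x y : nat) : bf := fun d => FEq (d - x - 1) (d - y - 1).
Definition bIn (x y : nat) : bf := fun d => FMem (d - x - 1) (d - y - 1).
Definition bSt (x : nat) : bf := fun d => FSt (d - x - 1).
Definition bImp (p q : bf) : bf := fun d => FImp (p d) (q d).
Definition bNot (p : bf) : bf := fun d => FNot (p d).
Definition bAnd (p q : bf) : bf := fun d => FAnd (p d) (q d).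
Definition bOr (p q : bf) : bf := fun d => FOr (p d) (q d).
Definition bIff (p q : bf) : bf := fun d => FIff (p d) (q d).
Definition bAll (f : nat -> bf) : bf := fun d => FAll (f d (S d)).
Definition bEx (f : nat -> bf) : bf := fun d => FEx (f d (S d)).
(** [emb vs Φ]: insert a raw formula Φ, whose indices 0..|vs|-1 denote the
    bound variables listed in vs (levels) and whose remaining indices
    |vs|, |vs|+1, ... are its parameters = free variables 0, 1, ... of the
    whole axiom. *)
Definition emb (vs : list nat) (p : form) : bf := fun d =>
  ren (fun i => if i <? length vs then d - nth i vs 0 - 1
                else d + (i - length vs)) p.

Definition bEmpty e := bAll (fun z => bNot (bIn z e)).
Definition bSucc y s := bAll (fun z => bIff (bIn z s) (bOr (bIn z y) (bEq z y))).
Definition bInd I :=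
  bAnd (bEx (fun e => bAnd (bEmpty e) (bIn e I)))
       (bAll (fun y => bImp (bIn y I) (bEx (fun s => bAnd (bSucc y s) (bIn s I))))).
Definition bNat x := bAll (fun I => bImp (bInd I) (bIn x I)).
(** p = (a,b) (Kuratowski pair) *)
Definition bPair a b p :=
  bAll (fun z => bIff (bIn z p)
    (bOr (bAll (fun w => bIff (bIn w z) (bEq w a)))
         (bAll (fun w => bIff (bIn w z) (bOr (bEq w a) (bEq w b)))))).
Definition bApp F a b := bEx (fun p => bAnd (bIn p F) (bPair a b p)).
Definition bFunc F :=
  bAnd (bAll (fun p => bImp (bIn p F) (bEx (fun a => bEx (fun b => bPair a b p)))))
       (bAll (fun a => bAll (fun b => bAll (fun b' =>
          bImp (bAnd (bApp F a b) (bApp F a b')) (bEq b b'))))).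
Definition bFunOnNat F :=
  bAnd (bFunc F) (bAll (fun a => bIff (bEx (fun b => bApp F a b)) (bNat a))).
Definition bFin A :=
  bEx (fun n => bAnd (bNat n) (bEx (fun f => bAnd (bFunc f)
    (bAnd (bAll (fun a => bIff (bEx (fun b => bApp f a b)) (bIn a n)))
    (bAnd (bAll (fun b => bIff (bIn b A) (bEx (fun a => bApp f a b))))
          (bAll (fun a => bAll (fun a' => bAll (fun b =>
             bImp (bAnd (bApp f a b) (bApp f a' b)) (bEq a a')))))))))).

Definition ax_ext : form := bAll (fun x => bAll (fun y =>
  bImp (bAll (fun z => bIff (bIn z x) (bIn z y))) (bEq x y))) 0.
Definition ax_found : form := bAll (fun x =>
  bImp (bEx (fun y => bIn y x))
       (bEx (fun y => bAnd (bIn y x) (bNot (bEx (fun z => bAnd (bIn z y) (bIn z x))))))) 0.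
Definition ax_pair : form := bAll (fun x => bAll (fun y =>
  bEx (fun z => bAnd (bIn x z) (bIn y z)))) 0.
Definition ax_union : form := bAll (fun F => bEx (fun A => bAll (fun Y => bAll (fun x =>
  bImp (bAnd (bIn x Y) (bIn Y F)) (bIn x A))))) 0.
Definition ax_inf : form := bEx (fun X => bInd X) 0.
Definition ax_pow : form := bAll (fun x => bEx (fun y => bAll (fun z =>
  bImp (bAll (fun w => bImp (bIn w z) (bIn w x))) (bIn z y)))) 0.
Definition ax_choice : form := bAll (fun X =>
  bImp (bAnd (bAll (fun x => bImp (bIn x X) (bEx (fun w => bIn w x))))
             (bAll (fun x => bAll (fun y => bImp (bAnd (bIn x X) (bAnd (bIn y X) (bNot (bEq x y))))
                                   (bNot (bEx (fun w => bAnd (bIn w x) (bIn w y)))))))) 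
       (bEx (fun C => bAll (fun x => bImp (bIn x X) (bEx (fun c =>
          bAnd (bIn c x) (bAnd (bIn c C) (bAll (fun c' =>
             bImp (bAnd (bIn c' x) (bIn c' C)) (bEq c' c)))))))))) 0.
Definition ax_sep (φ : form) : form := bAll (fun x => bEx (fun y => bAll (fun z =>
  bIff (bIn z y) (bAnd (bIn z x) (emb [z; x] φ))))) 0.
Definition ax_repl (φ : form) : form := bAll (fun A =>
  bImp (bAll (fun x => bImp (bIn x A) (bEx (fun y => bAnd (emb [x; y; A] φ)
          (bAll (fun y' => bImp (emb [x; y'; A] φ) (bEq y y')))))))
       (bEx (fun B => bAll (fun x => bImp (bIn x A)
          (bEx (fun y => bAnd (bIn y B) (emb [x; y; A] φ))))))) 0.

Definition ax_ideal (Φ : form) : form := bIff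
  (bAll (fun A => bImp (bAnd (bSt A) (bFin A))
     (bEx (fun x => bAll (fun a => bImp (bIn a A) (emb [x; a] Φ))))))
  (bEx (fun x => bAll (fun a => bImp (bSt a) (emb [x; a] Φ)))) 0.
Definition ax_stand (Φ : form) : form := bAll (fun X => bImp (bSt X)
  (bEx (fun Y => bAnd (bSt Y) (bAll (fun x => bImp (bSt x)
     (bIff (bIn x Y) (bAnd (bIn x X) (emb [x] Φ)))))))) 0.
(** Transfer: Φ(x, params) internal with parameters among free variables
    0..n-1 (index 0 of Φ is x), all assumed standard *)
Fixpoint stconj (n : nat) : form :=
  match n with 0 => FTop | S k => FAnd (FSt k) (stconj k) end.
Definition ax_transfer (n : nat) (Φ : form) : form :=
  FImp (stconj n) (FImp (FEx Φ) (FEx (FAnd (FSt 0) Φ))).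

Inductive IST_ax : form -> Prop :=
| IExt : IST_ax ax_ext
| IFound : IST_ax ax_found
| IPair : IST_ax ax_pair
| IUnion : IST_ax ax_union
| IInf : IST_ax ax_inf
| IPow : IST_ax ax_pow
| IChoice : IST_ax ax_choice
| ISep φ : internal φ -> IST_ax (ax_sep φ)
| IRepl φ : internal φ -> IST_ax (ax_repl φ)
| IIdeal Φ : internal Φ -> IST_ax (ax_ideal Φ)
| IStand Φ : IST_ax (ax_stand Φ)
| ITransfer n Φ : internal Φ -> bounded (S n) Φ -> IST_ax (ax_transfer n Φ).

Definition star : form := bAll (fun F => bImp (bFunOnNat F)
  (bImp (bAll (fun n => bImp (bAnd (bSt n) (bNat n))
           (bEx (fun v => bAnd (bApp F n v) (bSt v)))))
        (bEx (fun G => bAnd (bSt G) (bAnd (bFunOnNat G)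
           (bAll (fun n => bImp (bAnd (bSt n) (bNat n))
              (bEx (fun v => bAnd (bApp F n v) (bApp G n v)))))))))) 0.

(* Main.v *)
From Stdlib Require Import List Arith Lia Classical ClassicalEpsilon FunctionalExtensionality
  PropExtensionality Cantor.
Require Import Defs.
Import ListNotations.

(** In a model of IST let [W] be a standard limit level of the cumulative hierarchy that reflects the
    finitely many internal axioms used in a supposed proof of [Φ <-> (∗)], and also [Φ] itself.
    Idealization, Standardization and Transfer pass from the universe to [W], with the standard
    elements of [W] as the standard sets. Hence [Φ], [Φ] in [W], and (∗) in [W] are equivalent. But
    (∗) in [W] depends only on the cofinality of [W]:
    - if [W] is the union of an [ω]-chain of levels [X n], Idealization gives an internal [F] in [W]
      with [F n = X n] for all standard [n]; a standard [G] in [W] agreeing with it would, by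
      Transfer, contain the whole chain, so (∗) fails;
    - if [W] is closed under [ω]-sequences, Standardization in [W] gives the required [G], so (∗)
      holds.
    ZFC proves that limits of both kinds exist, so neither [Φ] nor its negation can hold. Limits of
    the second kind are indexed by a well-founded set in which every countable subset is bounded. *)

(** * Semantics and completeness *)

Definition econs {M : Type} (x : M) (v : nat -> M) (i : nat) : M :=
  match i with 0 => x | S k => v k end.
Infix ".:" := econs (at level 55, right associativity).

Lemma econs_eta {M} (v : nat -> M) : v 0 .: (fun i => v (S i)) = v.
Proof. apply functional_extensionality; intros [|i]; reflexivity. Qed.

Section Sat.
Context {M : Type} (E : M -> M -> Prop) (st dom : M -> Prop).

Fixpoint sat (v : nat -> M) (p : form) : Prop :=
  match p with
  | FEq i j => v i = v j
  | FMem i j => E (v i) (v j)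
  | FSt i => st (v i)
  | FBot => False
  | FImp p q => sat v p -> sat v q
  | FAll p => forall x, dom x -> sat (x .: v) p
  end.

Lemma sat_ren p : forall r v, sat v (ren r p) <-> sat (fun i => v (r i)) p.
Proof.
  induction p as [i j|i j|i| |p IHp q IHq|p IHp]; intros r v; simpl; try tauto.
  - rewrite IHp, IHq; tauto.
  - assert (H : forall x, (fun i => (x .: v) (upr r i)) = x .: (fun i => v (r i))).
    { intros x; apply functional_extensionality; intros [|i]; reflexivity. }
    split; intros K x Hx; specialize (K x Hx); rewrite IHp, H in *; exact K.
Qed.

Lemma sat_inst t p v : sat v (inst t p) <-> sat (v t .: v) p.
Proof.
  unfold inst; rewrite sat_ren.
  replace (fun i => v (scons t (fun k => k) i)) with (v t .: v); [tauto|].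
  apply functional_extensionality; intros [|i]; reflexivity.
Qed.

Lemma sat_bounded p : forall n v w, bounded n p -> (forall i, i < n -> v i = w i) ->
  (sat v p <-> sat w p).
Proof.
  induction p as [i j|i j|i| |p IHp q IHq|p IHp]; intros n v w Hb Hvw; simpl in *; try tauto.
  - destruct Hb; rewrite !Hvw; tauto.
  - destruct Hb; rewrite !Hvw; tauto.
  - rewrite Hvw; tauto.
  - destruct Hb as [Hp Hq]; rewrite (IHp n v w), (IHq n v w); tauto.
  - assert (H : forall x, sat (x .: v) p <-> sat (x .: w) p).
    { intros x; apply (IHp (S n)); [exact Hb|].
      intros [|i] Hi; simpl; [reflexivity|apply Hvw; lia]. }
    split; intros K x Hx; apply H; auto.
Qed.

Lemma sat_FAnd v p q : sat v (FAnd p q) <-> sat v p /\ sat v q.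
Proof. simpl; tauto. Qed.
Lemma sat_FEx v p : sat v (FEx p) <-> exists x, dom x /\ sat (x .: v) p.
Proof.
  simpl; split.
  - intros H; apply NNPP; intros K; apply H; intros x Hx Hp; apply K; eauto.
  - intros (x & Hx & Hp) K; exact (K x Hx Hp).
Qed.

Theorem soundness (T : form -> Prop) p :
  (forall q, T q -> forall v, (forall i, dom (v i)) -> sat v q) ->
  Prv T p -> forall v, (forall i, dom (v i)) -> sat v p.
Proof.
  intros HT H; induction H as [p Hp|p Hp|p q _ IH1 _ IH2|p _ IH]; intros v Hv.
  - exact (HT p Hp v Hv).
  - destruct Hp as [| | |p t| |p| |p i j].
    + simpl; tauto.
    + simpl; tauto.
    + simpl; apply NNPP.
    + intros K; apply sat_inst, K, Hv.
    + simpl; intros K1 K2 x Hx; apply K1, K2; exact Hx.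
    + simpl; intros K x _; apply sat_ren; exact K.
    + simpl; reflexivity.
    + simpl; rewrite !sat_inst; intros ->; tauto.
  - exact (IH1 v Hv (IH2 v Hv)).
  - intros x Hx; apply IH; intros [|i]; simpl; auto.
Qed.
End Sat.

Lemma Prv_mono (T U : form -> Prop) p : (forall q, T q -> U q) -> Prv T p -> Prv U p.
Proof.
  intros HTU H; induction H; eauto using PAx, PLog, PMP, PGen.
Qed.

Lemma Prv_finite T p : Prv T p ->
  exists L : list form, (forall q, In q L -> T q) /\ Prv (fun q => In q L) p.
Proof.
  intros H; induction H as [p Hp|p Hp|p q _ (L1 & H1 & P1) _ (L2 & H2 & P2)|p _ (L & H & P)].
  - exists [p]; split; [intros q [<-|[]]; exact Hp|apply PAx; left; reflexivity].
  - exists []; split; [intros q []|apply PLog, Hp].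
  - exists (L1 ++ L2); split.
    + intros r Hr; apply in_app_or in Hr; destruct Hr; auto.
    + apply PMP with p; [apply Prv_mono with (2 := P1)|apply Prv_mono with (2 := P2)];
        intros r Hr; apply in_or_app; auto.
  - exists L; split; [exact H|apply PGen, P].
Qed.

Lemma ren_ext p : forall n r s, bounded n p -> (forall i, i < n -> r i = s i) -> ren r p = ren s p.
Proof.
  induction p as [i j|i j|i| |p IHp q IHq|p IHp]; intros n r s Hb H; simpl in *; try reflexivity.
  - destruct Hb; rewrite !H; auto.
  - destruct Hb; rewrite !H; auto.
  - rewrite H; auto.
  - destruct Hb; f_equal; eauto.
  - f_equal; apply (IHp (S n)); [exact Hb|].
    intros [|i] Hi; simpl; [reflexivity|f_equal; apply H; lia].
Qed.

Lemma ren_ren p : forall r s, ren r (ren s p) = ren (fun i => r (s i)) p.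
Proof.
  induction p as [i j|i j|i| |p IHp q IHq|p IHp]; intros r s; simpl; try reflexivity.
  - rewrite IHp, IHq; reflexivity.
  - rewrite IHp; do 2 f_equal.
    apply functional_extensionality; intros [|i]; reflexivity.
Qed.

Lemma ren_id p : ren (fun i => i) p = p.
Proof.
  induction p as [i j|i j|i| |p IHp q IHq|p IHp]; simpl; try reflexivity; try congruence.
  replace (upr (fun i => i)) with (fun i : nat => i); [congruence|].
  apply functional_extensionality; intros [|i]; reflexivity.
Qed.

Lemma internal_ren p : forall r, internal p -> internal (ren r p).
Proof. induction p; simpl; firstorder. Qed.

Lemma bounded_mono p : forall n m, n <= m -> bounded n p -> bounded m p.
Proof.
  induction p as [i j|i j|i| |p IHp q IHq|p IHp]; intros n m Hnm; simpl; try (intuition lia).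
  - firstorder.
  - apply IHp; lia.
Qed.

Lemma bounded_exists p : exists n, bounded n p.
Proof.
  induction p as [i j|i j|i| |p [n Hn] q [m Hm]|p [n Hn]].
  - exists (S (i + j)); simpl; lia.
  - exists (S (i + j)); simpl; lia.
  - exists (S i); simpl; lia.
  - exists 0; exact I.
  - exists (n + m); split; [apply bounded_mono with n|apply bounded_mono with m]; auto; lia.
  - exists n; simpl; apply bounded_mono with n; [lia|exact Hn].
Qed.

Lemma bounded_ren p : forall n m r, bounded n p -> (forall i, i < n -> r i < m) ->
  bounded m (ren r p).
Proof.
  induction p as [i j|i j|i| |p IHp q IHq|p IHp]; intros n m r Hb H; simpl in *; auto.
  - destruct Hb; auto.
  - destruct Hb; auto.
  - destruct Hb; split; eauto.
  - apply (IHp (S n)); [exact Hb|]. intros [|i] Hi; simpl; [lia|].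
    specialize (H i); lia.
Qed.

Section Henkin.
Variable T : form -> Prop.

Lemma Prv_ren p r : Prv T p -> Prv T (ren r p).
Proof.
  intros H. destruct (bounded_exists p) as [n Hn].
  assert (K : forall n p r, Prv T p -> Prv T (ren (fun i => if i <? n then r i else i - n) p)).
  { clear. induction n as [|n IH]; intros p r H.
    - replace (ren _ p) with p; [exact H|].
      rewrite <- (ren_id p) at 1; f_equal; apply functional_extensionality; intros i.
      simpl; lia.
    - apply PGen in H. apply (IH _ (fun i => r (S i))) in H. simpl in H.
      apply (PMP T _ _ (PLog T _ (LA4 _ (r 0)))) in H. unfold inst in H.
      rewrite ren_ren in H.
      replace (fun i => if i <? S n then r i else i - S n) with
        (fun i => scons (r 0) (fun k : nat => k)
           (upr (fun i => if i <? n then r (S i) else i - n) i)); [exact H|].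
      apply functional_extensionality; intros [|i]; reflexivity. }
  specialize (K n p r H). erewrite ren_ext; [exact K|exact Hn|].
  intros i Hi; simpl. apply Nat.ltb_lt in Hi; rewrite Hi; reflexivity.
Qed.

Inductive Hyp (G : form -> Prop) : form -> Prop :=
| HHyp p : G p -> Hyp G p
| HThm p : Prv T p -> Hyp G p
| HMP p q : Hyp G (FImp p q) -> Hyp G p -> Hyp G q.

Definition add (G : form -> Prop) (p : form) : form -> Prop := fun q => G q \/ q = p.

Lemma Hyp_mono (G D : form -> Prop) p : (forall q, G q -> D q) -> Hyp G p -> Hyp D p.
Proof. intros H K; induction K; eauto using HHyp, HThm, HMP. Qed.

Lemma Hyp_log G p : LogAx p -> Hyp G p.
Proof. intros H; apply HThm, PLog, H. Qed.

Lemma Hyp_K G p q : Hyp G q -> Hyp G (FImp p q).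
Proof. intros H; eapply HMP; [apply Hyp_log, LA1|exact H]. Qed.

Lemma Hyp_I G p : Hyp G (FImp p p).
Proof.
  eapply HMP; [eapply HMP; [apply Hyp_log, LA2|]|]; apply Hyp_log; [apply LA1|apply (LA1 p p)].
Qed.

Lemma deduction G p q : Hyp (add G p) q -> Hyp G (FImp p q).
Proof.
  intros H; induction H as [q [Hq| ->]|q Hq|q r _ IH1 _ IH2].
  - apply Hyp_K, HHyp, Hq.
  - apply Hyp_I.
  - apply Hyp_K, HThm, Hq.
  - eapply HMP; [eapply HMP; [apply Hyp_log, LA2|exact IH1]|exact IH2].
Qed.

Lemma Hyp_contra G p : Hyp (add G (FNot p)) FBot -> Hyp G p.
Proof. intros H; eapply HMP; [apply Hyp_log, LA3|apply deduction, H]. Qed.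

Lemma Hyp_ren (G D : form -> Prop) r p : (forall q, G q -> D (ren r q)) ->
  Hyp G p -> Hyp D (ren r p).
Proof.
  intros H K; induction K as [p Hp|p Hp|p q _ IH1 _ IH2].
  - apply HHyp, H, Hp.
  - apply HThm, Prv_ren, Hp.
  - exact (HMP _ _ _ IH1 IH2).
Qed.

Lemma Hyp_gen (G : form -> Prop) p : Hyp (fun q => exists q', G q' /\ q = ren S q') p -> Hyp G (FAll p).
Proof.
  intros H; induction H as [p (q & Hq & ->)|p Hp|p q _ IH1 _ IH2].
  - eapply HMP; [apply Hyp_log, LA6|apply HHyp, Hq].
  - apply HThm, PGen, Hp.
  - eapply HMP; [eapply HMP; [apply Hyp_log, LA5|exact IH1]|exact IH2].
Qed.

Lemma Hyp_fresh G k p : (forall q, G q -> bounded k q) -> bounded (S k) p ->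
  Hyp G (inst k p) -> Hyp G (FAll p).
Proof.
  intros HG Hp H. apply Hyp_gen.
  set (r := fun i => if i =? k then 0 else S i).
  replace p with (ren r (inst k p)).
  - apply Hyp_ren with (2 := H). intros q Hq; exists q; split; [exact Hq|].
    apply ren_ext with k; [exact (HG q Hq)|]. intros i Hi; unfold r.
    destruct (Nat.eqb_spec i k); [lia|reflexivity].
  - unfold inst; rewrite ren_ren. rewrite <- (ren_id p) at 2.
    apply ren_ext with (S k); [exact Hp|].
    intros [|i] Hi; unfold r; simpl; [rewrite Nat.eqb_refl; reflexivity|].
    destruct (Nat.eqb_spec i k); [lia|reflexivity].
Qed.

Definition bd (p : form) : nat := epsilon (inhabits 0) (fun n => bounded n p).
Lemma bd_spec p : bounded (bd p) p.
Proof. exact (epsilon_spec (inhabits 0) (fun n => bounded n p) (bounded_exists p)). Qed.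

Fixpoint code (p : form) : nat :=
  match p with
  | FEq i j => to_nat (0, to_nat (i, j))
  | FMem i j => to_nat (1, to_nat (i, j))
  | FSt i => to_nat (2, i)
  | FBot => to_nat (3, 0)
  | FImp p q => to_nat (4, to_nat (code p, code q))
  | FAll p => to_nat (5, code p)
  end.

Lemma code_inj p : forall q, code p = code q -> p = q.
Proof.
  induction p as [i j|i j|i| |p IHp q IHq|p IHp]; intros [i' j'|i' j'|i'| |p' q'|p'] H;
    cbn [code] in H; apply to_nat_inj, pair_equal_spec in H; destruct H as [Ht H];
    try discriminate Ht; clear Ht; try reflexivity;
    try (apply to_nat_inj, pair_equal_spec in H; destruct H); f_equal; auto.
Qed.

Definition decode (n : nat) : form := epsilon (inhabits FBot) (fun p => code p = n).
Lemma decode_code p : decode (code p) = p.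
Proof.
  apply code_inj.
  exact (epsilon_spec (inhabits FBot) (fun q => code q = code p) (ex_intro _ p eq_refl)).
Qed.

Definition Con (G : form -> Prop) : Prop := ~ Hyp G FBot.

(* The free variables serve as Henkin constants: [k] is fresh for [G] and [p]. *)
Definition step (k : nat) (p : form) (G : form -> Prop) : form -> Prop := fun q =>
  G q \/ (Con (add G p) /\ q = p) \/
  (~ Con (add G p) /\ exists r, p = FAll r /\ q = FNot (inst k r)).

Fixpoint stage (n : nat) : nat * (form -> Prop) :=
  match n with
  | 0 => (0, fun _ => False)
  | S n => let (m, G) := stage n in
           let k := m + bd (decode n) in (S k, step k (decode n) G)
  end.

Definition Om (p : form) : Prop := exists n, snd (stage n) p.

Hypothesis HT : Consistent T.

Lemma stage_bounded n : forall q, snd (stage n) q -> bounded (fst (stage n)) q.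
Proof.
  induction n as [|n IH]; simpl; [tauto|].
  destruct (stage n) as [m G]; simpl in *. assert (Hd := bd_spec (decode n)).
  intros q [Hq|[[_ ->]|[_ (r & Hr & ->)]]].
  - apply bounded_mono with m; [lia|auto].
  - apply bounded_mono with (bd (decode n)); [lia|exact Hd].
  - rewrite Hr in Hd at 2. simpl in *. split; [|exact I].
    apply bounded_ren with (S (bd (decode n))); [exact Hd|].
    intros [|i] Hi; simpl; lia.
Qed.

Lemma stage_con n : Con (snd (stage n)).
Proof.
  induction n as [|n IH].
  - intros H. apply HT. simpl in H. remember FBot as b eqn:Hb. clear Hb.
    induction H; [contradiction|assumption|eapply PMP; eauto].
  - assert (HB := stage_bounded n).
    simpl. destruct (stage n) as [m G]; simpl in *.
    assert (Hd := bd_spec (decode n)). set (p := decode n) in *. set (k := m + bd p).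
    destruct (classic (Con (add G p))) as [HC|HC].
    + intros H; apply HC. apply Hyp_mono with (2 := H).
      intros q [Hq|[[_ ->]|[[] _]]]; [left|right| ]; auto.
    + assert (Hn : Hyp G (FNot p)) by (apply deduction, NNPP, HC).
      destruct (classic (exists r, p = FAll r)) as [(r & Hr)|Hr].
      * intros H. apply IH. eapply HMP; [exact Hn|]. rewrite Hr.
        apply Hyp_fresh with k.
        -- intros q Hq; apply bounded_mono with m; [unfold k; lia|auto].
        -- rewrite Hr in Hd at 2. simpl in Hd.
           apply bounded_mono with (2 := Hd). unfold k; lia.
        -- apply Hyp_contra. apply Hyp_mono with (2 := H).
           intros q [Hq|[[Hc ->]|[_ (r' & Hr' & ->)]]]; [left; auto|contradiction|right].
           congruence.
      * intros H; apply IH. apply Hyp_mono with (2 := H).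
        intros q [Hq|[[Hc ->]|[_ (r' & Hr' & ->)]]]; [auto|contradiction|].
        exfalso; eauto.
Qed.

Lemma stage_mono n m q : n <= m -> snd (stage n) q -> snd (stage m) q.
Proof.
  induction 1 as [|m _ IH]; [tauto|]. intros H; apply IH in H.
  simpl. destruct (stage m); simpl in *. left; exact H.
Qed.

Lemma Om_con : Con Om.
Proof.
  assert (K : forall p, Hyp Om p -> exists n, Hyp (snd (stage n)) p).
  { intros p H; induction H as [p [n Hn]|p Hp|p q _ [n IH1] _ [m IH2]].
    - exists n; apply HHyp, Hn.
    - exists 0; apply HThm, Hp.
    - exists (n + m). eapply HMP.
      + apply Hyp_mono with (2 := IH1). intros r; apply stage_mono; lia.
      + apply Hyp_mono with (2 := IH2). intros r; apply stage_mono; lia. }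
  intros H; destruct (K _ H) as [n Hn]. exact (stage_con n Hn).
Qed.

Lemma Om_or p : Om p \/ ~ Con (add Om p).
Proof.
  destruct (classic (Con (add (snd (stage (code p))) p))) as [H|H].
  - left; exists (S (code p)); simpl.
    destruct (stage (code p)); simpl in *. rewrite decode_code. right; left; auto.
  - right; intros K; apply H; intros L; apply K; apply Hyp_mono with (2 := L).
    intros q [Hq| ->]; [left; eexists; eauto|right; reflexivity].
Qed.

Lemma Om_closed p : Hyp Om p -> Om p.
Proof.
  intros H; destruct (Om_or p) as [K|K]; [exact K|exfalso].
  apply Om_con. eapply HMP; [apply deduction, NNPP, K|exact H].
Qed.

Lemma Om_imp p q : Om (FImp p q) <-> (Om p -> Om q).
Proof.
  split.
  - intros H K; apply Om_closed; eapply HMP; apply HHyp; eauto.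
  - intros H. destruct (Om_or p) as [K|K].
    + apply Om_closed, Hyp_K, HHyp, H, K.
    + apply Om_closed, deduction, Hyp_contra.
      apply Hyp_mono with (2 := NNPP _ K). intros r Hr; left; exact Hr.
Qed.

Lemma Om_bot : ~ Om FBot.
Proof. intros H; apply Om_con, HHyp, H. Qed.

Lemma Om_all p : Om (FAll p) <-> forall k, Om (inst k p).
Proof.
  split.
  - intros H k. apply Om_closed; eapply HMP; [apply Hyp_log, LA4|apply HHyp, H].
  - intros H. destruct (Om_or (FAll p)) as [K|K]; [exact K|exfalso].
    assert (Hd := decode_code (FAll p)). set (n := code (FAll p)) in Hd. clearbody n.
    destruct (classic (Con (add (snd (stage n)) (FAll p)))) as [L|L].
    + apply K. intros K'. apply Om_con. eapply HMP; [apply deduction, K'|].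
      apply HHyp. exists (S n); simpl.
      destruct (stage n); simpl in *. rewrite Hd. right; left; auto.
    + set (k := fst (stage n) + bd (decode n)).
      assert (Hk : Om (FNot (inst k p))).
      { exists (S n). unfold k. simpl.
        destruct (stage n) as [m G]; simpl in *.
        right; right. rewrite Hd in *. split; [exact L|]. exists p; auto. }
      apply Om_bot. exact (proj1 (Om_imp _ _) Hk (H k)).
Qed.

Definition eqv (i j : nat) : Prop := Om (FEq i j).

Lemma Om_subst p i j : eqv i j -> Om (inst i p) -> Om (inst j p).
Proof.
  intros H. apply Om_imp. revert H. apply Om_imp. apply Om_closed, Hyp_log, LA8.
Qed.

Lemma eqv_refl i : eqv i i.
Proof. apply Om_closed, Hyp_log, LA7. Qed.
Lemma eqv_sym i j : eqv i j -> eqv j i.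
Proof. intros H. exact (Om_subst (FEq 0 (S i)) i j H (eqv_refl i)). Qed.
Lemma eqv_trans i j k : eqv i j -> eqv j k -> eqv i k.
Proof. intros H1 H2. exact (Om_subst (FEq (S i) 0) j k H2 H1). Qed.

Definition rep (i : nat) : nat := epsilon (inhabits 0) (eqv i).
Lemma rep_eqv i : eqv i (rep i).
Proof. exact (epsilon_spec (inhabits 0) (eqv i) (ex_intro _ i (eqv_refl i))). Qed.
Lemma rep_eq i j : eqv i j -> rep i = rep j.
Proof.
  intros H; unfold rep; f_equal. apply functional_extensionality; intros k.
  apply propositional_extensionality; split; eauto using eqv_trans, eqv_sym.
Qed.
Lemma rep_idem i : rep (rep i) = rep i.
Proof. apply rep_eq, eqv_sym, rep_eqv. Qed.

Definition HM : Type := {i : nat | rep i = i}.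
Definition cls (i : nat) : HM := exist _ (rep i) (rep_idem i).
Lemma cls_val (x : HM) : cls (proj1_sig x) = x.
Proof.
  destruct x as [i Hi]; unfold cls; simpl.
  apply eq_sig_hprop; [intros; apply proof_irrelevance|exact Hi].
Qed.
Definition HE (x y : HM) : Prop := Om (FMem (proj1_sig x) (proj1_sig y)).
Definition Hst (x : HM) : Prop := Om (FSt (proj1_sig x)).

Lemma truth p : forall r, sat HE Hst (fun _ => True) (fun i => cls (r i)) p <-> Om (ren r p).
Proof.
  induction p as [i j|i j|i| |p IHp q IHq|p IHp]; intros r; simpl.
  - split; intros H.
    + apply (f_equal (@proj1_sig _ _)) in H; simpl in H.
      apply eqv_trans with (rep (r i)); [apply rep_eqv|]. rewrite H; apply eqv_sym, rep_eqv.
    + unfold cls. apply eq_sig_hprop; [intros; apply proof_irrelevance|].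
      simpl; apply rep_eq, H.
  - unfold HE; simpl. split; intros H.
    + apply (Om_subst (FMem 0 (S (r j))) (rep (r i))); [apply eqv_sym, rep_eqv|].
      apply (Om_subst (FMem (S (rep (r i))) 0) (rep (r j))); [apply eqv_sym, rep_eqv|exact H].
    + apply (Om_subst (FMem 0 (S (rep (r j)))) (r i)); [apply rep_eqv|].
      apply (Om_subst (FMem (S (r i)) 0) (r j)); [apply rep_eqv|exact H].
  - unfold Hst; simpl. split; intros H.
    + apply (Om_subst (FSt 0) (rep (r i))); [apply eqv_sym, rep_eqv|exact H].
    + apply (Om_subst (FSt 0) (r i)); [apply rep_eqv|exact H].
  - split; [tauto|apply Om_bot].
  - rewrite Om_imp, IHp, IHq; tauto.
  - rewrite Om_all.
    assert (K : forall k, sat HE Hst (fun _ => True) (cls k .: (fun i => cls (r i))) p <->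
                     Om (inst k (ren (upr r) p))).
    { intros k. unfold inst; rewrite ren_ren.
      replace (fun i => scons k (fun k0 => k0) (upr r i)) with (scons k r)
        by (apply functional_extensionality; intros [|i]; reflexivity).
      rewrite <- IHp.
      replace (fun i => cls (scons k r i)) with (cls k .: (fun i => cls (r i))); [tauto|].
      apply functional_extensionality; intros [|i]; reflexivity. }
    split.
    + intros H k; apply K, H, I.
    + intros H x _. rewrite <- (cls_val x). apply K, H.
Qed.

Theorem completeness : exists (M : Type) (E : M -> M -> Prop) (st : M -> Prop),
  inhabited M /\ forall p, T p -> forall v, sat E st (fun _ => True) v p.
Proof.
  exists HM, HE, Hst; split; [exact (inhabits (cls 0))|].
  intros p Hp v.
  replace v with (fun i => cls (proj1_sig (v i)))
    by (apply functional_extensionality; intros i; apply cls_val).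
  apply truth, Om_closed, HThm, Prv_ren, PAx, Hp.
Qed.
End Henkin.

(** * Definable predicates *)

Section Definability.
Context {M : Type} (E : M -> M -> Prop) (st : M -> Prop).
Notation sat0 := (sat E st (fun _ => True)).

Inductive isTm (C : M -> Prop) : ((nat -> M) -> M) -> Prop :=
| TVar i : isTm C (fun v => v i)
| TCst c : C c -> isTm C (fun _ => c).

(* Predicates definable with parameters satisfying [C], by an internal formula if [b = true]. *)
Inductive Df (C : M -> Prop) (b : bool) : ((nat -> M) -> Prop) -> Prop :=
| DfMem t s : isTm C t -> isTm C s -> Df C b (fun v => E (t v) (s v))
| DfEq t s : isTm C t -> isTm C s -> Df C b (fun v => t v = s v)
| DfSt t : b = false -> isTm C t -> Df C b (fun v => st (t v))
| DfBot : Df C b (fun _ => False)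
| DfImp P Q : Df C b P -> Df C b Q -> Df C b (fun v => P v -> Q v)
| DfAll (P : (nat -> M) -> M -> Prop) :
    Df C b (fun v => P (fun i => v (S i)) (v 0)) -> Df C b (fun v => forall x, P v x)
| DfExt P Q : (forall v, P v <-> Q v) -> Df C b P -> Df C b Q.

Section Closure.
Context (C : M -> Prop) (b : bool).
Implicit Types P Q : (nat -> M) -> Prop.

Lemma DfNot P : Df C b P -> Df C b (fun v => ~ P v).
Proof. intros H; apply DfImp; [exact H|apply DfBot]. Qed.
Lemma DfAnd P Q : Df C b P -> Df C b Q -> Df C b (fun v => P v /\ Q v).
Proof.
  intros HP HQ. apply DfExt with (fun v => ~ (P v -> ~ Q v)); [intros v; tauto|].
  apply DfNot, DfImp; [|apply DfNot]; assumption.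
Qed.
Lemma DfOr P Q : Df C b P -> Df C b Q -> Df C b (fun v => P v \/ Q v).
Proof.
  intros HP HQ. apply DfExt with (fun v => ~ P v -> Q v); [intros v; tauto|].
  apply DfImp; [apply DfNot|]; assumption.
Qed.
Lemma DfIff P Q : Df C b P -> Df C b Q -> Df C b (fun v => P v <-> Q v).
Proof. intros HP HQ. apply DfAnd; apply DfImp; assumption. Qed.
Lemma DfEx (P : (nat -> M) -> M -> Prop) :
  Df C b (fun v => P (fun i => v (S i)) (v 0)) -> Df C b (fun v => exists x, P v x).
Proof.
  intros H. apply DfExt with (fun v => ~ forall x, ~ P v x).
  - intros v; split; [apply not_all_not_ex|firstorder].
  - apply DfNot, DfAll, DfNot, H.
Qed.
Lemma DfTrue : Df C b (fun _ => True).
Proof. apply DfExt with (fun _ => False -> False); [tauto|apply DfImp; apply DfBot]. Qed.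

Lemma isTm_subst (s : (nat -> M) -> nat -> M) t :
  (forall i, isTm C (fun v => s v i)) -> isTm C t -> isTm C (fun v => t (s v)).
Proof. intros Hs Ht; destruct Ht as [i|c Hc]; [apply Hs|apply TCst, Hc]. Qed.

Lemma isTm_shift t : isTm C t -> isTm C (fun v => t (fun i => v (S i))).
Proof. apply isTm_subst; intros i; apply TVar. Qed.

Lemma Df_subst P : Df C b P -> forall s : (nat -> M) -> nat -> M,
  (forall i, isTm C (fun v => s v i)) -> Df C b (fun v => P (s v)).
Proof.
  intros H; induction H as [t u Ht Hu|t u Ht Hu|t Hb Ht| |P Q _ IH1 _ IH2|P _ IH|P Q HPQ _ IH];
    intros s Hs.
  - apply DfMem; apply isTm_subst; assumption.
  - apply DfEq; apply isTm_subst; assumption.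
  - apply DfSt; [assumption|apply isTm_subst; assumption].
  - apply DfBot.
  - apply DfImp; auto.
  - apply (DfAll C b (fun v x => P (s v) x)).
    apply (IH (fun v => v 0 .: s (fun i => v (S i)))).
    intros [|i]; simpl; [apply TVar|].
    apply (isTm_shift (fun v => s v i)), Hs.
  - apply DfExt with (fun v => P (s v)); auto.
Qed.

Lemma Df_app1 (P : M -> Prop) t : Df C b (fun v => P (v 0)) -> isTm C t ->
  Df C b (fun v => P (t v)).
Proof.
  intros H Ht. apply (Df_subst _ H (fun v _ => t v)). intros i; exact Ht.
Qed.
Lemma Df_app2 (P : M -> M -> Prop) t s : Df C b (fun v => P (v 0) (v 1)) -> isTm C t -> isTm C s ->
  Df C b (fun v => P (t v) (s v)).
Proof.
  intros H Ht Hs. apply (Df_subst _ H (fun v => t v .: fun _ => s v)).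
  intros [|i]; simpl; assumption.
Qed.
End Closure.

Definition join (v p : nat -> M) (i : nat) : M :=
  if Nat.even i then v (Nat.div2 i) else p (Nat.div2 i).

Lemma join_ext (v p w : nat -> M) : (forall i, w (2 * i) = v i) -> (forall i, w (S (2 * i)) = p i) ->
  w = join v p.
Proof.
  intros H1 H2. apply functional_extensionality; intros i. unfold join.
  destruct (Nat.Even_or_Odd i) as [[k ->]|[k ->]].
  - rewrite H1, Nat.even_even. rewrite Nat.div2_double; reflexivity.
  - rewrite Nat.add_1_r, Nat.even_succ, Nat.odd_even, Nat.div2_succ_double, H2; reflexivity.
Qed.
Lemma join_even v p i : join v p (2 * i) = v i.
Proof. unfold join. rewrite Nat.even_even, Nat.div2_double; reflexivity. Qed.
Lemma join_odd v p i : join v p (S (2 * i)) = p i.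
Proof. unfold join. rewrite Nat.even_succ, Nat.odd_even, Nat.div2_succ_double; reflexivity. Qed.

Lemma isTm_index C t c0 : C c0 -> isTm C t ->
  exists i p, (forall k, C (p k)) /\ forall v, join v p i = t v.
Proof.
  intros Hc [i|c Hc'].
  - exists (2 * i), (fun _ => c0); split; [auto|]. intros v; apply join_even.
  - exists 1, (fun _ => c); split; [auto|]. intros v; reflexivity.
Qed.

Definition rl (j : nat) : nat := if Nat.even j then j else S (2 * (2 * Nat.div2 j)).
Definition rr (j : nat) : nat := if Nat.even j then j else S (2 * (S (2 * Nat.div2 j))).

Lemma join_rl v p q : (fun j => join v (join p q) (rl j)) = join v p.
Proof.
  apply join_ext; intros i; unfold rl.
  - rewrite Nat.even_even; apply join_even.
  - rewrite Nat.even_succ, Nat.odd_even, Nat.div2_succ_double, join_odd, join_even; reflexivity.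
Qed.
Lemma join_rr v p q : (fun j => join v (join p q) (rr j)) = join v q.
Proof.
  apply join_ext; intros i; unfold rr.
  - rewrite Nat.even_even; apply join_even.
  - rewrite Nat.even_succ, Nat.odd_even, Nat.div2_succ_double, join_odd, join_odd; reflexivity.
Qed.

Lemma join_C (C : M -> Prop) p q : (forall i, C (p i)) -> (forall i, C (q i)) -> forall i, C (join p q i).
Proof. intros Hp Hq i; unfold join; destruct (Nat.even i); auto. Qed.

Lemma Df_form C b P c0 : C c0 -> Df C b P -> exists phi p,
  (b = true -> internal phi) /\ (forall i, C (p i)) /\ forall v, sat0 (join v p) phi <-> P v.
Proof.
  intros Hc H; induction H as [t u Ht Hu|t u Ht Hu|t Hb Ht| |P Q _ IH1 _ IH2|P _ IH|P Q HPQ _ IH].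
  - destruct (isTm_index _ _ _ Hc Ht) as (i & p & Hp & Hi).
    destruct (isTm_index _ _ _ Hc Hu) as (j & q & Hq & Hj).
    exists (FMem (rl i) (rr j)), (join p q). split; [simpl; auto|]. split; [apply join_C; auto|].
    intros v. simpl. rewrite <- Hi, <- Hj, <- (join_rl v p q), <- (join_rr v p q). reflexivity.
  - destruct (isTm_index _ _ _ Hc Ht) as (i & p & Hp & Hi).
    destruct (isTm_index _ _ _ Hc Hu) as (j & q & Hq & Hj).
    exists (FEq (rl i) (rr j)), (join p q). split; [simpl; auto|]. split; [apply join_C; auto|].
    intros v. simpl. rewrite <- Hi, <- Hj, <- (join_rl v p q), <- (join_rr v p q). reflexivity.
  - destruct (isTm_index _ _ _ Hc Ht) as (i & p & Hp & Hi).
    exists (FSt i), p. split; [congruence|]. split; [auto|].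
    intros v. simpl. rewrite <- Hi. reflexivity.
  - exists FBot, (fun _ => c0). split; [simpl; auto|]. split; [auto|]. simpl; tauto.
  - destruct IH1 as (f & p & Hf & Hp & H1). destruct IH2 as (g & q & Hg & Hq & H2).
    exists (FImp (ren rl f) (ren rr g)), (join p q). split; [|split; [apply join_C; auto|]].
    + intros Hb; split; apply internal_ren; auto.
    + intros v. simpl. rewrite !sat_ren, join_rl, join_rr, H1, H2. tauto.
  - destruct IH as (f & p & Hf & Hp & H1).
    exists (FAll (ren (fun j => if Nat.even j then pred j else S j) f)), p.
    split; [|split; [auto|]].
    + intros Hb. simpl. apply internal_ren; auto.
    + intros v. simpl.
      assert (K : forall x, sat0 (x .: join v p) (ren (fun j => if Nat.even j then pred j else S j) f)
                       <-> P v x).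
      { intros x. rewrite sat_ren.
        replace (fun i => (x .: join v p) (if Nat.even i then pred i else S i)) with (join (x .: v) p).
        - apply H1.
        - symmetry; apply join_ext; intros i.
          + rewrite Nat.even_even. destruct i as [|i]; [reflexivity|].
            replace (pred (2 * S i)) with (S (2 * i)) by lia. exact (join_even v p i).
          + rewrite Nat.even_succ, Nat.odd_even. exact (join_odd v p i). }
      split; intros L x; [|intros _]; apply K; auto.
  - destruct IH as (f & p & Hf & Hp & H1). exists f, p. split; [auto|split; [auto|]].
    intros v. rewrite H1. apply HPQ.
Qed.

(* The variables of [P] from the [k]-th on are identified. *)
Lemma Df_formk k C b P c0 : C c0 -> Df C b P -> exists phi p,
  (b = true -> internal phi) /\ (forall i, C (p i)) /\
  forall w, sat0 (fun i => if i <=? k then w i else p (i - S k)) phi <-> P (fun i => w (min i k)).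
Proof.
  intros Hc H. destruct (Df_form _ _ _ _ Hc H) as (f & p & Hf & Hp & K).
  exists (ren (fun j => if Nat.even j then min (Nat.div2 j) k else S k + Nat.div2 j) f), p.
  split; [intros Hb; apply internal_ren; auto|split; [exact Hp|]].
  intros w. rewrite sat_ren, <- K.
  match goal with |- sat _ _ _ ?a _ <-> sat _ _ _ ?b _ => replace a with b; [tauto|] end.
  symmetry; apply join_ext; intros i.
  - rewrite Nat.even_even, Nat.div2_double.
    destruct (Nat.leb_spec (min i k) k); [reflexivity|lia].
  - rewrite Nat.even_succ, Nat.odd_even, Nat.div2_succ_double.
    destruct (Nat.leb_spec (S k + i) k); [lia|]. f_equal; lia.
Qed.

Lemma Df_form1 C b (P : M -> Prop) c0 : C c0 -> Df C b (fun v => P (v 0)) -> exists phi p,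
  (b = true -> internal phi) /\ (forall i, C (p i)) /\ forall x, sat0 (x .: p) phi <-> P x.
Proof.
  intros Hc H. destruct (Df_formk 0 _ _ _ _ Hc H) as (f & p & Hf & Hp & K).
  exists f, p. split; [exact Hf|split; [exact Hp|]]. intros x. rewrite <- (K (fun _ => x)).
  match goal with |- sat _ _ _ ?a _ <-> sat _ _ _ ?b _ => replace a with b; [tauto|] end.
  apply functional_extensionality; intros [|i]; [reflexivity|].
  cbn [econs Nat.leb]. f_equal; lia.
Qed.
Lemma Df_form2 C b (P : M -> M -> Prop) c0 : C c0 -> Df C b (fun v => P (v 0) (v 1)) -> exists phi p,
  (b = true -> internal phi) /\ (forall i, C (p i)) /\
  forall x y, sat0 (x .: y .: p) phi <-> P x y.
Proof.
  intros Hc H. destruct (Df_formk 1 _ _ _ _ Hc H) as (f & p & Hf & Hp & K).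
  exists f, p. split; [exact Hf|split; [exact Hp|]].
  intros x y. rewrite <- (K (x .: fun _ => y)).
  match goal with |- sat _ _ _ ?a _ <-> sat _ _ _ ?b _ => replace a with b; [tauto|] end.
  apply functional_extensionality; intros [|[|i]]; [reflexivity|reflexivity|].
  cbn [econs Nat.leb]. f_equal; lia.
Qed.
Lemma Df_form3 C b (P : M -> M -> M -> Prop) c0 : C c0 -> Df C b (fun v => P (v 0) (v 1) (v 2)) ->
  exists phi p, (b = true -> internal phi) /\ (forall i, C (p i)) /\
  forall x y z, sat0 (x .: y .: z .: p) phi <-> P x y z.
Proof.
  intros Hc H. destruct (Df_formk 2 _ _ _ _ Hc H) as (f & p & Hf & Hp & K).
  exists f, p. split; [exact Hf|split; [exact Hp|]].
  intros x y z. rewrite <- (K (x .: y .: fun _ => z)).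
  match goal with |- sat _ _ _ ?a _ <-> sat _ _ _ ?b _ => replace a with b; [tauto|] end.
  apply functional_extensionality; intros [|[|[|i]]]; [reflexivity..|].
  cbn [econs Nat.leb]. f_equal; lia.
Qed.

Lemma Df_sat (C : M -> Prop) b (D : M -> Prop) : Df C b (fun v => D (v 0)) ->
  forall p, (b = true -> internal p) -> Df C b (fun v => sat E st D v p).
Proof.
  intros HD p; induction p as [i j|i j|i| |p IHp q IHq|p IHp]; simpl; intros Hp.
  - apply (DfEq C b (fun v => v i) (fun v => v j)); apply TVar.
  - apply (DfMem C b (fun v => v i) (fun v => v j)); apply TVar.
  - destruct b; [destruct (Hp eq_refl)|]. apply (DfSt C false (fun v => v i)); [reflexivity|apply TVar].
  - apply DfBot.
  - apply (DfImp C b (fun v => sat E st D v p) (fun v => sat E st D v q));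
      [apply IHp|apply IHq]; intros Hb; destruct (Hp Hb); assumption.
  - apply (DfAll C b (fun v x => D x -> sat E st D (x .: v) p)).
    apply (DfImp C b (fun v => D (v 0)) (fun v => sat E st D (v 0 .: fun i => v (S i)) p)); [exact HD|].
    apply DfExt with (fun v => sat E st D v p); [|auto].
    intros v; rewrite econs_eta; tauto.
Qed.
End Definability.

Arguments TVar {M C} i.
Arguments TCst {M C} c.

Ltac istm := cbn [econs]; solve [ assumption
  | match goal with |- isTm _ (fun v => v ?i) => exact (TVar i) end
  | match goal with |- isTm _ (fun _ => ?c) => apply (TCst c); first [exact I | assumption | trivial] end
  | match goal with |- isTm ?C (fun v => ?t (fun i => v (S i))) => apply (isTm_shift C t); istm end ].

(** * Set theory inside a model *)

Section Predicates.
Context {M : Type} (E : M -> M -> Prop).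

Definition empty e := forall z, ~ E z e.
Definition issucc y s := forall z, E z s <-> E z y \/ z = y.
Definition ind I := (exists e, empty e /\ E e I) /\
  (forall y, E y I -> exists s, issucc y s /\ E s I).
Definition isnat x := forall I, ind I -> E x I.
Definition pair a b p := forall z, E z p <->
  (forall w, E w z <-> w = a) \/ (forall w, E w z <-> w = a \/ w = b).
Definition app F a b := exists p, E p F /\ pair a b p.
Definition func F := (forall p, E p F -> exists a b, pair a b p) /\
  (forall a b b', app F a b /\ app F a b' -> b = b').
Definition funN F := func F /\ (forall a, (exists b, app F a b) <-> isnat a).
Definition fin A := exists n, isnat n /\ exists f, func f /\
  (forall a, (exists b, app f a b) <-> E a n) /\
  (forall b, E b A <-> exists a, app f a b) /\
  (forall a a' b, app f a b /\ app f a' b -> a = a').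
Definition sub x y := forall z, E z x -> E z y.
End Predicates.

Create HintDb dfu.
#[global] Hint Unfold empty issucc ind isnat pair app func funN fin sub : dfu.

Ltac df := intros; cbv beta; first
  [ assumption
  | apply DfMem; istm
  | apply DfEq; istm
  | apply DfSt; [reflexivity|istm]
  | apply DfBot
  | apply DfTrue
  | match goal with
    | H : Df _ _ _ _ (fun v => ?P (v 0)) |- Df _ _ _ _ (fun v => ?P (@?t v)) =>
        apply (Df_app1 _ _ _ _ P t H); istm
    | H : Df _ _ _ _ (fun v => ?P (v 0) (v 1)) |- Df _ _ _ _ (fun v => ?P (@?t v) (@?s v)) =>
        apply (Df_app2 _ _ _ _ P t s H); istm
    end
  | apply DfNot; df
  | apply DfIff; df
  | apply DfAnd; df
  | apply DfOr; df
  | apply DfImp; df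
  | apply DfEx; df
  | apply DfAll; df
  | progress autounfold with dfu; df ].

Section Semantics.
Context {M : Type} (E : M -> M -> Prop) (st dom : M -> Prop).
Notation sat1 := (sat E st dom).

Lemma sat_bAll v f d (A : M -> Prop) : (forall x, dom x -> (sat1 (x .: v) (f d (S d)) <-> A x)) ->
  (sat1 v (bAll f d) <-> forall x, dom x -> A x).
Proof. intros H; simpl; split; intros K x Hx; specialize (H x Hx); specialize (K x Hx); tauto. Qed.
Lemma sat_bEx v f d (A : M -> Prop) : (forall x, dom x -> (sat1 (x .: v) (f d (S d)) <-> A x)) ->
  (sat1 v (bEx f d) <-> exists x, dom x /\ A x).
Proof.
  intros H; unfold bEx; rewrite sat_FEx; split; intros (x & Hx & K); exists x;
    (split; [exact Hx|]); specialize (H x Hx); tauto.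
Qed.
Lemma sat_bImp v p q d A B : (sat1 v (p d) <-> A) -> (sat1 v (q d) <-> B) ->
  (sat1 v (bImp p q d) <-> (A -> B)).
Proof. simpl; tauto. Qed.
Lemma sat_bAnd v p q d A B : (sat1 v (p d) <-> A) -> (sat1 v (q d) <-> B) ->
  (sat1 v (bAnd p q d) <-> A /\ B).
Proof. intros H K; unfold bAnd; rewrite sat_FAnd; tauto. Qed.
Lemma sat_bOr v p q d A B : (sat1 v (p d) <-> A) -> (sat1 v (q d) <-> B) ->
  (sat1 v (bOr p q d) <-> A \/ B).
Proof. intros H K; simpl; tauto. Qed.
Lemma sat_bNot v p d A : (sat1 v (p d) <-> A) -> (sat1 v (bNot p d) <-> ~ A).
Proof. simpl; tauto. Qed.
Lemma sat_bIff v p q d A B : (sat1 v (p d) <-> A) -> (sat1 v (q d) <-> B) ->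
  (sat1 v (bIff p q d) <-> (A <-> B)).
Proof. intros H K; unfold bIff, FIff; rewrite sat_FAnd; simpl; tauto. Qed.
End Semantics.

Section Semantics0.
Context {M : Type} (E : M -> M -> Prop) (st : M -> Prop).
Notation sat0 := (sat E st (fun _ => True)).
Lemma sat0_bAll v f d (A : M -> Prop) : (forall x, (sat0 (x .: v) (f d (S d)) <-> A x)) ->
  (sat0 v (bAll f d) <-> forall x, A x).
Proof. intros H; simpl; split; intros K x; [|intros _]; specialize (H x); specialize (K x); tauto. Qed.
Lemma sat0_bEx v f d (A : M -> Prop) : (forall x, (sat0 (x .: v) (f d (S d)) <-> A x)) ->
  (sat0 v (bEx f d) <-> exists x, A x).
Proof.
  intros H; unfold bEx; rewrite sat_FEx; split; [intros (x & _ & K)|intros (x & K)]; exists x;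
    [|split; [exact I|]]; specialize (H x); tauto.
Qed.
End Semantics0.

Ltac headof t := lazymatch t with ?f _ => headof f | _ => t end.

Ltac sem := intros; cbv beta; lazymatch goal with
  | |- sat _ _ (fun _ => True) _ (bAll _ _) <-> _ => apply sat0_bAll; sem
  | |- sat _ _ (fun _ => True) _ (bEx _ _) <-> _ => apply sat0_bEx; sem
  | |- sat _ _ _ _ (bAll _ _) <-> _ => apply sat_bAll; sem
  | |- sat _ _ _ _ (bEx _ _) <-> _ => apply sat_bEx; sem
  | |- sat _ _ _ _ (bImp _ _ _) <-> _ => apply sat_bImp; sem
  | |- sat _ _ _ _ (bAnd _ _ _) <-> _ => apply sat_bAnd; sem
  | |- sat _ _ _ _ (bOr _ _ _) <-> _ => apply sat_bOr; sem
  | |- sat _ _ _ _ (bNot _ _) <-> _ => apply sat_bNot; sem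
  | |- sat _ _ _ _ (bIff _ _ _) <-> _ => apply sat_bIff; sem
  | |- sat _ _ _ _ (bIn _ _ _) <-> _ => reflexivity
  | |- sat _ _ _ _ (bEq _ _ _) <-> _ => reflexivity
  | |- sat _ _ _ _ (bSt _ _) <-> _ => reflexivity
  | |- sat _ _ _ _ (emb _ _ _) <-> _ => idtac
  | |- sat _ _ _ _ ?t <-> _ => let h := headof t in unfold h; sem
  end.

Section ZF.
Context {M : Type} (E : M -> M -> Prop) (st : M -> Prop).
Notation sat0 := (sat E st (fun _ => True)).
Notation DF := (Df E st (fun _ => True) true).
Notation "x ∈ y" := (E x y) (at level 70).
Context (HI : forall p, IST_ax p -> forall v, sat0 v p).
Context (m0 : M).

Lemma ext x y : (forall z, z ∈ x <-> z ∈ y) -> x = y.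
Proof.
  revert x y. assert (H := HI _ IExt (fun _ => m0)).
  match goal with |- ?G => assert (K : sat0 (fun _ => m0) ax_ext <-> G) by sem end.
  tauto.
Qed.

Lemma foundation x : (exists y, y ∈ x) -> exists y, y ∈ x /\ ~ exists z, z ∈ y /\ z ∈ x.
Proof.
  revert x. assert (H := HI _ IFound (fun _ => m0)).
  match goal with |- ?G => assert (K : sat0 (fun _ => m0) ax_found <-> G) by sem end.
  tauto.
Qed.

Lemma pairing x y : exists z, x ∈ z /\ y ∈ z.
Proof.
  revert x y. assert (H := HI _ IPair (fun _ => m0)).
  match goal with |- ?G => assert (K : sat0 (fun _ => m0) ax_pair <-> G) by sem end.
  tauto.
Qed.

Lemma union_bound F : exists A, forall Y x, x ∈ Y /\ Y ∈ F -> x ∈ A.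
Proof.
  revert F. assert (H := HI _ IUnion (fun _ => m0)).
  match goal with |- ?G => assert (K : sat0 (fun _ => m0) ax_union <-> G) by sem end.
  tauto.
Qed.

Lemma infinity : exists I, ind E I.
Proof.
  assert (H := HI _ IInf (fun _ => m0)).
  match goal with |- ?G => assert (K : sat0 (fun _ => m0) ax_inf <-> G) by sem end.
  tauto.
Qed.

Lemma power_bound x : exists y, forall z, (forall w, w ∈ z -> w ∈ x) -> z ∈ y.
Proof.
  revert x. assert (H := HI _ IPow (fun _ => m0)).
  match goal with |- ?G => assert (K : sat0 (fun _ => m0) ax_pow <-> G) by sem end.
  tauto.
Qed.

Lemma choice_set X : 
  (forall x, x ∈ X -> exists w, w ∈ x) /\
  (forall x y, x ∈ X /\ y ∈ X /\ ~ x = y -> ~ exists w, w ∈ x /\ w ∈ y) ->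
  exists C, forall x, x ∈ X -> exists c, c ∈ x /\ c ∈ C /\ forall c', c' ∈ x /\ c' ∈ C -> c' = c.
Proof.
  revert X. assert (H := HI _ IChoice (fun _ => m0)).
  match goal with |- ?G => assert (K : sat0 (fun _ => m0) ax_choice <-> G) by sem end.
  tauto.
Qed.

Lemma sat_emb dom v vs p d : sat E st dom v (emb vs p d) <->
  sat E st dom (fun i => v (if i <? length vs then d - nth i vs 0 - 1 else d + (i - length vs))) p.
Proof. apply sat_ren. Qed.

Lemma separation (P : M -> Prop) : DF (fun v => P (v 0)) ->
  forall x, exists y, forall z, z ∈ y <-> z ∈ x /\ P z.
Proof.
  intros HP.
  destruct (Df_form2 E st _ true (fun z _ => P z) m0 I HP) as (f & p & Hf & _ & Hs).
  assert (H := HI _ (ISep f (Hf eq_refl)) p).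
  match goal with |- ?G => assert (K : sat0 p (ax_sep f) <-> G); [|tauto] end.
  sem. rewrite sat_emb, <- (Hs x1 x).
  match goal with |- sat _ _ _ ?a _ <-> sat _ _ _ ?b _ => replace a with b; [tauto|] end.
  apply functional_extensionality; intros [|[|i]]; simpl; rewrite ?Nat.sub_0_r; reflexivity.
Qed.

Lemma replacement (R : M -> M -> Prop) : DF (fun v => R (v 0) (v 1)) ->
  forall A, (forall x, x ∈ A -> exists y, R x y) ->
  (forall x y y', x ∈ A -> R x y -> R x y' -> y = y') ->
  exists B, forall y, y ∈ B <-> exists x, x ∈ A /\ R x y.
Proof.
  intros HR.
  destruct (Df_form3 E st _ true (fun x y _ => R x y) m0 I HR) as (f & p & Hf & _ & Hs).
  assert (H := HI _ (IRepl f (Hf eq_refl)) p).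
  assert (K : sat0 p (ax_repl f) <-> forall A,
    (forall x, x ∈ A -> exists y, R x y /\ forall y', R x y' -> y = y') ->
    exists B, forall x, x ∈ A -> exists y, y ∈ B /\ R x y).
  { sem; rewrite sat_emb; [rewrite <- (Hs x0 x1 x)|rewrite <- (Hs x0 x2 x)|rewrite <- (Hs x1 x2 x)].
    all: match goal with |- sat _ _ _ ?a _ <-> sat _ _ _ ?b _ => replace a with b; [tauto|] end.
    all: apply functional_extensionality; intros [|[|[|i]]]; simpl; rewrite ?Nat.sub_0_r; reflexivity. }
  intros A H1 H2.
  destruct (proj1 K H A) as [B HB].
  { intros x Hx. destruct (H1 x Hx) as [y Hy]. exists y; eauto. }
  destruct (separation (fun y => exists x, x ∈ A /\ R x y)) with (x := B) as [B' HB'].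
  { df. }
  exists B'. intros y. rewrite HB'. split; [tauto|].
  intros (x & Hx & Hy). split; [|eauto].
  destruct (HB x Hx) as (y' & Hy' & Hr). rewrite (H2 x y y'); auto.
Qed.

Definition upair x y := epsilon (inhabits m0) (fun z => forall w, w ∈ z <-> w = x \/ w = y).
Lemma upair_spec x y w : w ∈ upair x y <-> w = x \/ w = y.
Proof.
  revert w. apply (epsilon_spec (inhabits m0) (fun z => forall w, w ∈ z <-> w = x \/ w = y)).
  destruct (pairing x y) as (z & Hx & Hy).
  destruct (separation (fun w => w = x \/ w = y)) with (x := z) as [u Hu]; [df|].
  exists u. intros w; rewrite Hu. intuition congruence.
Qed.

Definition op a b := upair (upair a a) (upair a b).
Lemma pair_op a b p : pair E a b p <-> p = op a b.
Proof.
  assert (K : forall z, z ∈ op a b <-> (forall w, w ∈ z <-> w = a) \/ (forall w, w ∈ z <-> w = a \/ w = b)).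
  { intros z. unfold op; rewrite upair_spec. split.
    - intros [-> | ->]; [left|right]; intros w; rewrite upair_spec; tauto.
    - intros [H|H]; [left|right]; apply ext; intros w; rewrite upair_spec, H; tauto. }
  split.
  - intros H; apply ext; intros z. rewrite K. apply H.
  - intros ->. exact K.
Qed.

Lemma upair_inj a b c : upair a b = upair a c -> b = c.
Proof.
  intros H.
  assert (Hb : b = a \/ b = c) by (rewrite <- upair_spec, <- H, upair_spec; auto).
  assert (Hc : c = a \/ c = b) by (rewrite <- upair_spec, H, upair_spec; auto).
  intuition congruence.
Qed.
Lemma op_inj a b c d : op a b = op c d -> a = c /\ b = d.
Proof.
  intros H.
  assert (Ha : a = c).
  { assert (K : upair a a ∈ op c d) by (rewrite <- H; apply upair_spec; auto).
    apply upair_spec in K. destruct K as [K|K].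
    - assert (L : a ∈ upair c c) by (rewrite <- K; apply upair_spec; auto).
      apply upair_spec in L; tauto.
    - assert (L : c ∈ upair a a) by (rewrite K; apply upair_spec; auto).
      apply upair_spec in L; intuition congruence. }
  subst c. split; [reflexivity|].
  apply upair_inj in H. apply upair_inj in H. exact H.
Qed.

Lemma app_op F a b : app E F a b <-> op a b ∈ F.
Proof.
  split.
  - intros (p & Hp & H). apply pair_op in H; subst; exact Hp.
  - intros H; exists (op a b); split; [exact H|apply pair_op; reflexivity].
Qed.

Lemma union_exists F : exists A, forall x, x ∈ A <-> exists Y, x ∈ Y /\ Y ∈ F.
Proof.
  destruct (union_bound F) as [A HA].
  destruct (separation (fun x => exists Y, x ∈ Y /\ Y ∈ F)) with (x := A) as [B HB]; [df|].
  exists B. intros x; rewrite HB. split; [tauto|]. intros (Y & H1 & H2); split; eauto.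
Qed.
Lemma power_exists x : exists y, forall z, z ∈ y <-> sub E z x.
Proof.
  destruct (power_bound x) as [A HA].
  destruct (separation (fun z => sub E z x)) with (x := A) as [B HB]; [df|].
  exists B. intros z; rewrite HB. split; [tauto|]. intros H; split; auto.
Qed.
Lemma bunion_exists x y : exists u, forall z, z ∈ u <-> z ∈ x \/ z ∈ y.
Proof.
  destruct (union_exists (upair x y)) as [u Hu]. exists u; intros z; rewrite Hu. split.
  - intros (Y & H1 & H2). apply upair_spec in H2. intuition (subst; auto).
  - intros [H|H]; [exists x|exists y]; (split; [exact H|apply upair_spec; auto]).
Qed.
Lemma insert_exists x a : exists u, forall z, z ∈ u <-> z ∈ x \/ z = a.
Proof.
  destruct (bunion_exists x (upair a a)) as [u Hu]. exists u; intros z.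
  rewrite Hu, upair_spec; tauto.
Qed.

Lemma mem_irrefl x : ~ x ∈ x.
Proof.
  intros H. destruct (foundation (upair x x)) as (y & Hy & K).
  { exists x; apply upair_spec; auto. }
  apply upair_spec in Hy. apply K. exists x. assert (y = x) as -> by tauto.
  split; [exact H|apply upair_spec; auto].
Qed.

Lemma empty_exists : exists e, empty E e.
Proof. destruct infinity as (I & (e & He & _) & _). eauto. Qed.
Lemma empty_unique e e' : empty E e -> empty E e' -> e = e'.
Proof. intros H K; apply ext; intros z; split; intros L; [destruct (H z L)|destruct (K z L)]. Qed.
Lemma issucc_exists y : exists s, issucc E y s.
Proof. apply insert_exists. Qed.
Lemma issucc_unique y s s' : issucc E y s -> issucc E y s' -> s = s'.
Proof. intros H K; apply ext; intros z; rewrite (H z), (K z); tauto. Qed.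

Lemma nat_empty e : empty E e -> isnat E e.
Proof.
  intros H I [(e' & H1 & H2) _]. rewrite (empty_unique e e'); auto.
Qed.
Lemma nat_succ n s : isnat E n -> issucc E n s -> isnat E s.
Proof.
  intros Hn Hs I HInd. assert (K := Hn I HInd). destruct HInd as [_ H].
  destruct (H n K) as (s' & H1 & H2). rewrite (issucc_unique n s s'); auto.
Qed.
Lemma omega_exists : exists o, forall n, n ∈ o <-> isnat E n.
Proof.
  destruct infinity as [I HInd].
  destruct (separation (isnat E)) with (x := I) as [o Ho]; [df|].
  exists o; intros n; rewrite Ho. split; [tauto|]. intros H; split; [apply H, HInd|exact H].
Qed.
Lemma isnat_ind (P : M -> Prop) : DF (fun v => P (v 0)) -> (forall e, empty E e -> P e) ->
  (forall n s, isnat E n -> P n -> issucc E n s -> P s) -> forall n, isnat E n -> P n.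
Proof.
  intros HP H0 HS n Hn. destruct omega_exists as [o Ho].
  destruct (separation P HP o) as [u Hu].
  apply (Hu n), Hn. split.
  - destruct empty_exists as [e He]. exists e; split; [exact He|].
    apply Hu; split; [apply Ho, nat_empty, He|auto].
  - intros y Hy. apply Hu in Hy. destruct Hy as [Hy Py]. apply Ho in Hy.
    destruct (issucc_exists y) as [s Hs]. exists s; split; [exact Hs|].
    apply Hu; split; [apply Ho, (nat_succ y); auto|eauto].
Qed.

Lemma fin_ind (P : M -> Prop) : DF (fun v => P (v 0)) ->
  (forall e, empty E e -> P e) ->
  forall A, (forall B x B', P B -> x ∈ A -> (forall z, z ∈ B' <-> z ∈ B \/ z = x) -> P B') ->
  fin E A -> P A.
Proof.
  intros HP H0 A HS (n & Hn & f & Hf & Hdom & HA & _).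
  assert (K : forall j, isnat E j ->
    forall B, (forall b, b ∈ B <-> exists i, i ∈ j /\ app E f i b) -> P B).
  { apply (isnat_ind (fun j => forall B, (forall b, b ∈ B <-> exists i, i ∈ j /\ app E f i b) -> P B)); [df| |].
    - intros e He B HB. apply H0. intros b Hb. apply HB in Hb.
      destruct Hb as (i & Hi & _). exact (He i Hi).
    - intros j s _ IH Hs B HB.
      destruct (separation (fun b => exists i, i ∈ j /\ app E f i b)) with (x := A) as [B0 HB0]; [df|].
      assert (HB0' : forall b, b ∈ B0 <-> exists i, i ∈ j /\ app E f i b).
      { intros b; rewrite HB0; split; [tauto|]. intros (i & Hi & K); split; [apply HA|]; eauto. }
      assert (P0 := IH B0 HB0').
      destruct (classic (exists b, app E f j b)) as [[b Hb]|Hnb].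
      + apply (HS B0 b); [exact P0|apply HA; eauto|]. intros z. rewrite HB, HB0'. split.
        * intros (i & Hi & K). apply Hs in Hi. destruct Hi as [Hi| ->]; [eauto|right].
          destruct Hf as [_ Hf]; eauto.
        * intros [(i & Hi & K)| ->]; [exists i|exists j]; (split; [apply Hs; auto|assumption]).
      + replace B with B0; [exact P0|]. apply ext; intros z. rewrite HB, HB0'. split.
        * intros (i & Hi & K); exists i; split; [apply Hs; auto|exact K].
        * intros (i & Hi & K). apply Hs in Hi. destruct Hi as [Hi| ->]; [eauto|].
          exfalso; eauto. }
  apply (K n Hn). intros b. rewrite HA. split.
  - intros (a & Ha). exists a; split; [apply Hdom; eauto|exact Ha].
  - intros (i & _ & Hi); eauto.
Qed.

Lemma fin_empty e : empty E e -> fin E e.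
Proof.
  intros He. exists e. split; [apply nat_empty, He|]. exists e.
  assert (K : forall a b, ~ app E e a b) by (intros a b (p & Hp & _); exact (He p Hp)).
  split; [split|split; [|split]].
  - intros p Hp; destruct (He p Hp).
  - intros a b b' [H _]; destruct (K _ _ H).
  - intros a; split; [intros [b Hb]; destruct (K _ _ Hb)|intros H; destruct (He a H)].
  - intros b; split; [intros H; destruct (He b H)|intros [a Ha]; destruct (K _ _ Ha)].
  - intros a a' b [H _]; destruct (K _ _ H).
Qed.

Lemma fin_insert A x A' : fin E A -> (forall z, z ∈ A' <-> z ∈ A \/ z = x) -> fin E A'.
Proof.
  intros HA HA'. destruct (classic (x ∈ A)) as [Hx|Hx].
  { replace A' with A; [exact HA|]. apply ext; intros z; rewrite HA'. intuition congruence. }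
  destruct HA as (n & Hn & f & [Hf1 Hf2] & Hdom & Hran & Hinj).
  destruct (issucc_exists n) as [s Hs]. exists s. split; [apply (nat_succ n); auto|].
  destruct (insert_exists f (op n x)) as [g Hg].
  assert (Happ : forall a b, app E g a b <-> app E f a b \/ (a = n /\ b = x)).
  { intros a b. rewrite !app_op, Hg. split.
    - intros [H|H]; [auto|]. apply op_inj in H; auto.
    - intros [H|[-> ->]]; auto. }
  assert (Hnn : forall b, ~ app E f n b).
  { intros b Hb. apply (mem_irrefl n), Hdom; eauto. }
  assert (Hxx : forall a, ~ app E f a x).
  { intros a Ha. apply Hx, Hran; eauto. }
  exists g. split; [split|split; [|split]].
  - intros p Hp. apply Hg in Hp. destruct Hp as [Hp| ->]; [auto|].
    exists n, x. apply pair_op; reflexivity.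
  - intros a b b'. rewrite !Happ. intros [[H1|[-> ->]] [H2|[H3 ->]]]; subst; eauto.
    + exfalso; eapply Hnn; eauto.
    + exfalso; eapply Hnn; eauto.
  - intros a. rewrite (Hs a), <- Hdom. split.
    + intros [b Hb]. apply Happ in Hb. destruct Hb as [Hb|[-> _]]; eauto.
    + intros [[b Hb]| ->]; [exists b|exists x]; apply Happ; auto.
  - intros b. rewrite HA', Hran. split.
    + intros [[a Ha]| ->]; [exists a|exists n]; apply Happ; auto.
    + intros [a Ha]. apply Happ in Ha. destruct Ha as [Ha|[_ ->]]; eauto.
  - intros a a' b. rewrite !Happ. intros [[H1|[-> ->]] [H2|[H3 H4]]]; subst; eauto.
    + exfalso; eapply Hxx; eauto.
    + exfalso; eapply Hxx; eauto.
Qed.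

Section Recursion.
Context (I : M) (R G : M -> M -> Prop).
Context (HR : DF (fun v => R (v 0) (v 1))) (HG : DF (fun v => G (v 0) (v 1))).
Context (wf : forall U, (forall x, x ∈ U -> x ∈ I) -> (exists x, x ∈ U) ->
  exists m, m ∈ U /\ forall y, y ∈ U -> ~ R y m).
Context (Gtot : forall u, exists y, G u y) (Gfun : forall u y y', G u y -> G u y' -> y = y').

Definition attempt p := forall a y, app E p a y -> a ∈ I /\
  (forall b, b ∈ I -> R b a -> exists z, app E p b z) /\
  exists u, G u y /\ forall z, z ∈ u <-> exists b, b ∈ I /\ R b a /\ app E p b z.
Definition rec a y := exists p, attempt p /\ app E p a y.

Lemma Df_rec : DF (fun v => rec (v 0) (v 1)).
Proof. unfold rec, attempt. df. Qed.

Lemma rec_dom a y : rec a y -> a ∈ I.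
Proof. intros (p & Hp & H). apply (Hp a y H). Qed.

Lemma wf_ind (P : M -> Prop) : DF (fun v => P (v 0)) ->
  (forall a, a ∈ I -> (forall b, b ∈ I -> R b a -> P b) -> P a) -> forall a, a ∈ I -> P a.
Proof.
  intros HP H a Ha. apply NNPP; intros Hn.
  destruct (separation (fun a => ~ P a)) with (x := I) as [U HU]; [df|].
  destruct (wf U) as (m & Hm & Hmin).
  - intros x Hx; apply HU in Hx; tauto.
  - exists a; apply HU; auto.
  - apply HU in Hm. destruct Hm as [HmI Hm]. apply Hm, H; [exact HmI|].
    intros b Hb Hr. apply NNPP; intros Hnb. apply (Hmin b); [apply HU; auto|exact Hr].
Qed.

Lemma rec_fun a y y' : rec a y -> rec a y' -> y = y'.
Proof.
  intros Hy. assert (Ha := rec_dom a y Hy). revert y y' Hy.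
  apply wf_ind with (P := fun a => forall y y', rec a y -> rec a y' -> y = y'); [|clear a Ha|exact Ha].
  { assert (H := Df_rec). df. }
  intros a Ha IH y y' (p & Hp & Hy) (q & Hq & Hy').
  destruct (Hp a y Hy) as (_ & Dp & u & Gu & Hu). destruct (Hq a y' Hy') as (_ & Dq & u' & Gu' & Hu').
  apply Gfun with u; [exact Gu|]. replace u with u'; [exact Gu'|].
  apply ext; intros z. rewrite Hu, Hu'. split; intros (b & Hb & Hr & Hz); exists b; repeat split; auto.
  - destruct (Dp b Hb Hr) as [z' Hz']. rewrite (IH b Hb Hr z z'); [exact Hz'|exists q|exists p]; auto.
  - destruct (Dq b Hb Hr) as [z' Hz']. rewrite (IH b Hb Hr z z'); [exact Hz'|exists p|exists q]; auto.
Qed.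

Lemma rec_eq a y : rec a y ->
  exists u, G u y /\ forall z, z ∈ u <-> exists b, b ∈ I /\ R b a /\ rec b z.
Proof.
  intros (p & Hp & Hy). destruct (Hp a y Hy) as (Ha & D & u & Gu & Hu).
  exists u; split; [exact Gu|]. intros z; rewrite Hu. split; intros (b & Hb & Hr & Hz); exists b.
  - repeat split; auto. exists p; auto.
  - repeat split; auto. destruct (D b Hb Hr) as [z' Hz'].
    rewrite (rec_fun b z z'); [exact Hz'|exact Hz|exists p; auto].
Qed.

Lemma rec_tot a : a ∈ I -> exists y, rec a y.
Proof.
  assert (Hrec := Df_rec).
  revert a; apply wf_ind; [df|]. intros a Ha IH. apply NNPP; intros Hn.
  destruct (separation (fun b => R b a)) with (x := I) as [Pa HPa]; [df|].
  destruct (replacement rec Hrec Pa) as [u Hu].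
  { intros b Hb; apply HPa in Hb; apply IH; tauto. }
  { intros b y y' _; apply rec_fun. }
  destruct (Gtot u) as [y Gy].
  destruct (separation (fun b => exists z, rec b z)) with (x := I) as [J HJ]; [df|].
  destruct (replacement (fun b q => exists z, rec b z /\ pair E b z q)) with (A := J) as [p0 Hp0].
  { df. }
  { intros b Hb. apply HJ in Hb. destruct Hb as [_ [z Hz]]. exists (op b z), z.
    split; [exact Hz|apply pair_op; reflexivity]. }
  { intros b q q' _ (z & Hz & Hq) (z' & Hz' & Hq'). apply pair_op in Hq, Hq'. subst.
    rewrite (rec_fun b z z'); auto. }
  assert (App0 : forall b z, app E p0 b z <-> rec b z).
  { intros b z. rewrite app_op, Hp0. split.
    - intros (c & _ & z' & Hz' & Hq). apply pair_op, op_inj in Hq. destruct Hq; subst; exact Hz'.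
    - intros Hz. exists b. split; [apply HJ; split; [exact (rec_dom _ _ Hz)|eauto]|].
      exists z; split; [exact Hz|apply pair_op; reflexivity]. }
  destruct (insert_exists p0 (op a y)) as [p Hp].
  assert (App : forall b z, app E p b z <-> rec b z \/ (b = a /\ z = y)).
  { intros b z. rewrite app_op, Hp, <- app_op, App0. split.
    - intros [H|H]; [auto|apply op_inj in H; auto].
    - intros [H|[-> ->]]; auto. }
  apply Hn. exists y, p. split; [|apply App; auto].
  intros c w Hc. apply App in Hc. destruct Hc as [Hc|[-> ->]].
  - split; [exact (rec_dom _ _ Hc)|]. assert (Hc' := Hc). destruct Hc' as (q & Hq & Hc').
    destruct (Hq c w Hc') as (_ & D & _).
    split.
    + intros b Hb Hr. destruct (D b Hb Hr) as [z Hz]. exists z; apply App; left; exists q; auto.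
    + destruct (rec_eq c w Hc) as (v & Gv & Hv). exists v; split; [exact Gv|].
      intros z; rewrite Hv. split; intros (b & Hb & Hr & Hz); exists b; repeat split; auto.
      * apply App; auto.
      * apply App in Hz. destruct Hz as [Hz|[-> ->]]; [exact Hz|].
        exfalso. destruct (D a Hb Hr) as [z Hz]. apply Hn; exists z, q; auto.
  - split; [exact Ha|split].
    + intros b Hb Hr. destruct (IH b Hb Hr) as [z Hz]. exists z; apply App; auto.
    + exists u; split; [exact Gy|]. intros z; rewrite Hu. split.
      * intros (b & Hb & Hz). apply HPa in Hb. exists b. repeat split; try tauto. apply App; auto.
      * intros (b & Hb & Hr & Hz). exists b; split; [apply HPa; auto|].
        apply App in Hz. destruct Hz as [Hz|[-> ->]]; [exact Hz|].
        exfalso. destruct (wf (upair a a)) as (m & Hm & Hmin).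
        -- intros x Hx; apply upair_spec in Hx; destruct Hx as [-> | ->]; exact Ha.
        -- exists a; apply upair_spec; auto.
        -- assert (m = a) as -> by (apply upair_spec in Hm; tauto). exact (Hmin a Hm Hr).
Qed.
End Recursion.

(** * Levels of the cumulative hierarchy *)

Lemma wf_mem I U : (forall x, x ∈ U -> x ∈ I) -> (exists x, x ∈ U) ->
  exists m, m ∈ U /\ forall y, y ∈ U -> ~ y ∈ m.
Proof.
  intros _ H. destruct (foundation U H) as (m & Hm & K). exists m; split; [exact Hm|eauto].
Qed.

Definition trans x := forall y, y ∈ x -> sub E y x.
Definition potent x := forall y z, y ∈ x -> sub E z y -> z ∈ x.

Lemma transitive_superset x0 : exists T, trans T /\ sub E x0 T.
Proof.
  destruct omega_exists as [o Ho].
  pose (G := fun u y => forall z, z ∈ y <-> z ∈ x0 \/ exists a, a ∈ u /\ exists w, w ∈ a /\ z ∈ w).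
  assert (HG : DF (fun v => G (v 0) (v 1))) by (unfold G; df).
  assert (Gtot : forall u, exists y, G u y).
  { intros u. destruct (union_exists u) as [a Ha]. destruct (union_exists a) as [b Hb].
    destruct (bunion_exists x0 b) as [y Hy]. exists y. intros z. rewrite Hy, Hb.
    split; (intros [H|H]; [auto|right]).
    - destruct H as (w & Hz & Hw). apply Ha in Hw. destruct Hw as (c & Hw & Hc). eauto.
    - destruct H as (c & Hc & w & Hw & Hz). exists w; split; [exact Hz|apply Ha; eauto]. }
  assert (Gfun : forall u y y', G u y -> G u y' -> y = y').
  { intros u y y' H K; apply ext; intros z; rewrite (H z), (K z); tauto. }
  assert (HR : DF (fun v => v 0 ∈ v 1)) by df.
  pose (X := rec o E G). assert (HX : DF (fun v => X (v 0) (v 1))) by exact (Df_rec o E G HR HG).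
  assert (Xtot : forall n, isnat E n -> exists y, X n y).
  { intros n Hn. apply (rec_tot o E G HR HG (wf_mem o) Gtot Gfun), Ho, Hn. }
  destruct (replacement X HX o) as [u Hu].
  { intros n Hn; apply Xtot, Ho, Hn. }
  { intros n y y' _. apply (rec_fun o E G HR HG (wf_mem o) Gfun). }
  destruct (union_exists u) as [T HT]. exists T. split.
  - intros w Hw z Hz. apply HT in Hw. destruct Hw as (a & Hwa & Ha).
    apply Hu in Ha. destruct Ha as (n & Hn & Ha). apply Ho in Hn.
    destruct (issucc_exists n) as [s Hs]. assert (Hsn := nat_succ n s Hn Hs).
    destruct (Xtot s Hsn) as [y Hy]. apply HT. exists y; split; [|apply Hu; exists s; split; [apply Ho|]; auto].
    destruct (rec_eq _ _ _ HR HG (wf_mem o) Gfun s y Hy) as (v & Gv & Hv).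
    apply Gv. right. exists a. split; [|eauto]. apply Hv. exists n.
    split; [apply Ho, Hn|split; [apply Hs; auto|exact Ha]].
  - intros z Hz. destruct empty_exists as [e He]. assert (Hn := nat_empty e He).
    destruct (Xtot e Hn) as [y Hy]. apply HT. exists y; split; [|apply Hu; exists e; split; [apply Ho|]; auto].
    destruct (rec_eq _ _ _ HR HG (wf_mem o) Gfun e y Hy) as (v & Gv & Hv).
    apply Gv; auto.
Qed.

Lemma mem_ind (P : M -> Prop) : DF (fun v => P (v 0)) ->
  (forall x, (forall y, y ∈ x -> P y) -> P x) -> forall x, P x.
Proof.
  intros HP H x. apply NNPP; intros Hx.
  destruct (transitive_superset (upair x x)) as (T & HT & HxT).
  destruct (separation (fun y => ~ P y)) with (x := T) as [U HU]; [df|].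
  destruct (foundation U) as (m & Hm & K).
  { exists x; apply HU; split; [apply HxT, upair_spec; auto|exact Hx]. }
  apply HU in Hm. destruct Hm as [HmT Hm]. apply Hm, H. intros y Hy. apply NNPP; intros Hn.
  apply K; exists y; split; [exact Hy|]. apply HU; split; [exact (HT m HmT y Hy)|exact Hn].
Qed.

(* The levels of Scott and Button are the sets [V_α] of ZFC, obtained from histories without
   ordinals; a history is the set of all levels below a given one. *)
Definition hist h := forall a, a ∈ h -> forall x, x ∈ a <-> exists c, c ∈ h /\ c ∈ a /\ sub E x c.
Definition lev s := exists h, hist h /\ forall x, x ∈ s <-> exists c, c ∈ h /\ sub E x c.

Lemma Df_lev C b : Df E st C b (fun v => lev (v 0)).
Proof. unfold lev, hist. df. Qed.

Lemma hist_trans h a : hist h -> a ∈ h -> trans a.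
Proof.
  intros Hh Ha. apply NNPP; intros Hn.
  destruct (separation (fun a => ~ trans a)) with (x := h) as [U HU]; [unfold trans; df|].
  destruct (foundation U) as (m & Hm & K); [exists a; apply HU; auto|].
  apply HU in Hm. destruct Hm as [Hmh Hm]. apply Hm. intros b Hb x Hx.
  apply (Hh m Hmh) in Hb. destruct Hb as (c & Hc & Hcm & Hbc).
  apply (Hh m Hmh). exists c. repeat split; auto.
  apply NNPP; intros Hxc. apply K; exists c; split; [exact Hcm|]. apply HU; split; [exact Hc|].
  intros Hct. apply Hxc, Hct, Hbc, Hx.
Qed.

Lemma sub_refl x : sub E x x.
Proof. intros z; auto. Qed.

Lemma lev_trans s : lev s -> trans s.
Proof.
  intros (h & Hh & Hs) y Hy x Hx. apply Hs in Hy. destruct Hy as (c & Hc & Hyc).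
  apply Hs. exists c; split; [exact Hc|]. apply (hist_trans h c Hh Hc), Hyc, Hx.
Qed.
Lemma lev_potent s : lev s -> potent s.
Proof.
  intros (h & Hh & Hs) y z Hy Hz. apply Hs in Hy. destruct Hy as (c & Hc & Hyc).
  apply Hs. exists c; split; [exact Hc|]. intros w Hw; apply Hyc, Hz, Hw.
Qed.
Lemma hist_lev h a : hist h -> a ∈ h -> lev a.
Proof.
  intros Hh Ha. destruct (separation (fun c => c ∈ a)) with (x := h) as [h' Hh']; [df|].
  exists h'. split.
  - intros b Hb x. apply Hh' in Hb. destruct Hb as [Hb Hba]. rewrite (Hh b Hb). split.
    + intros (c & Hc & Hcb & Hx). exists c. repeat split; auto. apply Hh'; split; [exact Hc|].
      exact (hist_trans h a Hh Ha b Hba c Hcb).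
    + intros (c & Hc & Hcb & Hx). exists c. apply Hh' in Hc. tauto.
  - intros x. rewrite (Hh a Ha). split; intros (c & Hc); exists c; rewrite Hh' in *; tauto.
Qed.
Lemma lev_mem s x : lev s -> x ∈ s -> exists c, lev c /\ c ∈ s /\ sub E x c.
Proof.
  intros (h & Hh & Hs) Hx. apply Hs in Hx. destruct Hx as (c & Hc & Hx). exists c.
  split; [exact (hist_lev h c Hh Hc)|split; [|exact Hx]]. apply Hs; exists c; auto using sub_refl.
Qed.

Lemma lev_min (P : M -> Prop) : DF (fun v => P (v 0)) -> (exists s, lev s /\ P s) ->
  exists s, lev s /\ P s /\ forall r, lev r -> P r -> ~ r ∈ s.
Proof.
  intros HP (s & Hs & Ps). assert (HL := Df_lev (fun _ => True) true).
  destruct (separation (fun r => lev r /\ P r)) with (x := s) as [U HU]; [df|].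
  destruct (classic (exists r, r ∈ U)) as [HUe|HUe].
  - destruct (foundation U HUe) as (m & Hm & K). apply HU in Hm. destruct Hm as (Hms & Hml & Pm).
    exists m. repeat split; auto. intros r Hr Pr Hrm. apply K. exists r; split; [exact Hrm|].
    apply HU. repeat split; auto. exact (lev_trans s Hs m Hms r Hrm).
  - exists s. repeat split; auto. intros r Hr Pr Hrs. apply HUe. exists r; apply HU; auto.
Qed.

Lemma lev_total s t : lev s -> lev t -> s ∈ t \/ s = t \/ t ∈ s.
Proof.
  intros Hs Ht. apply NNPP; intros Hn. assert (HL := Df_lev (fun _ => True) true).
  destruct (lev_min (fun s => exists t, lev t /\ ~ (s ∈ t \/ s = t \/ t ∈ s)))
    as (s' & Hs' & (t0 & Ht0 & Hn0) & Hmin); [df|exists s; split; eauto|]. clear s t Hs Ht Hn.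
  destruct (lev_min (fun t => ~ (s' ∈ t \/ s' = t \/ t ∈ s'))) as (t & Ht & Hn & Hmint);
    [df|exists t0; auto|]. clear t0 Ht0 Hn0.
  apply Hn. right; left. apply ext; intros x; split; intros Hx.
  - destruct (lev_mem s' x Hs' Hx) as (c & Hc & Hcs & Hxc).
    assert (K : c ∈ t \/ c = t \/ t ∈ c).
    { apply NNPP; intros K. apply (Hmin c); eauto. }
    destruct K as [K|[->|K]].
    + exact (lev_potent t Ht c x K Hxc).
    + tauto.
    + exfalso. apply Hn. right; right. exact (lev_trans s' Hs' c Hcs t K).
  - destruct (lev_mem t x Ht Hx) as (c & Hc & Hct & Hxc).
    assert (K : s' ∈ c \/ s' = c \/ c ∈ s').
    { apply NNPP; intros K. apply (Hmint c); eauto. }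
    destruct K as [K|[->|K]].
    + exfalso. apply Hn. left. exact (lev_trans t Ht c Hct s' K).
    + tauto.
    + exact (lev_potent s' Hs' c x K Hxc).
Qed.

Lemma lev_above u : (forall s, s ∈ u -> lev s) -> exists t, lev t /\ forall s, s ∈ u -> s ∈ t.
Proof.
  intros Hu. assert (HL := Df_lev (fun _ => True) true).
  destruct (union_exists u) as [U HU]. destruct (bunion_exists u U) as [V HV].
  destruct (separation lev) with (x := V) as [h Hh]; [df|].
  assert (Hh' : hist h).
  { intros a Ha x. apply Hh in Ha. destruct Ha as [Ha La]. split.
    - intros Hx. destruct (lev_mem a x La Hx) as (c & Lc & Hca & Hxc). exists c.
      split; [|auto]. apply Hh. split; [|exact Lc]. apply HV. right. apply HU.
      apply HV in Ha. destruct Ha as [Ha|Ha]; [eauto|]. apply HU in Ha.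
      destruct Ha as (s & Has & Hs). exists s; split; [|exact Hs].
      exact (lev_trans s (Hu s Hs) a Has c Hca).
    - intros (c & Hc & Hca & Hxc). exact (lev_potent a La c x Hca Hxc). }
  destruct (union_exists h) as [W HW]. destruct (power_exists W) as [Q HQ].
  destruct (separation (fun x => exists c, c ∈ h /\ sub E x c)) with (x := Q) as [t Ht]; [df|].
  exists t. split.
  - exists h; split; [exact Hh'|]. intros x. rewrite Ht. split; [tauto|].
    intros (c & Hc & Hx). split; [|eauto]. apply HQ. intros z Hz. apply HW. exists c; auto.
  - intros s Hs. assert (Hsh : s ∈ h) by (apply Hh; split; [apply HV; auto|auto]).
    apply Ht. split; [|exists s; auto using sub_refl]. apply HQ. intros z Hz. apply HW; eauto.
Qed.

Definition least (P : M -> Prop) s := lev s /\ P s /\ forall r, lev r -> P r -> ~ r ∈ s.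
Lemma least_unique P s t : least P s -> least P t -> s = t.
Proof.
  intros (Ls & Ps & Ms) (Lt & Pt & Mt).
  destruct (lev_total s t Ls Lt) as [H|[H|H]]; [|exact H|].
  - destruct (Mt s Ls Ps H).
  - destruct (Ms t Lt Pt H).
Qed.

Lemma lev_bound (P : M -> M -> Prop) : DF (fun v => P (v 0) (v 1)) ->
  (forall x s t, lev s -> lev t -> s ∈ t -> P x s -> P x t) ->
  forall Y, (forall x, x ∈ Y -> exists s, lev s /\ P x s) ->
  exists s, lev s /\ forall x, x ∈ Y -> P x s.
Proof.
  intros HP Hmono Y HY. assert (HL := Df_lev (fun _ => True) true).
  destruct (replacement (fun x => least (P x))) with (A := Y) as [u Hu].
  - unfold least; df.
  - intros x Hx. destruct (lev_min (P x)) as [s Hs]; [df|auto|exists s; exact Hs].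
  - intros x y y' _; apply least_unique.
  - destruct (lev_above u) as (t & Lt & Ht).
    { intros s Hs. apply Hu in Hs. destruct Hs as (x & _ & Hs & _); exact Hs. }
    exists t; split; [exact Lt|]. intros x Hx. destruct (lev_min (P x)) as [s Hs]; [df|auto|].
    apply Hmono with s; try apply Hs; [exact Lt|]. apply Ht, Hu; exists x; split; [exact Hx|exact Hs].
Qed.

Lemma lev_sub x : exists s, lev s /\ sub E x s.
Proof.
  assert (HL := Df_lev (fun _ => True) true). revert x; apply mem_ind; [df|]. intros x IH.
  destruct (lev_bound (fun y s => y ∈ s)) with (Y := x) as (s & Ls & Hs); [df| | |].
  - intros y s t Ls Lt Hst Hy. exact (lev_trans t Lt s Hst y Hy).
  - intros y Hy. destruct (IH y Hy) as (s & Ls & Hs).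
    destruct (lev_above (upair s s)) as (t & Lt & Ht).
    { intros r Hr. apply upair_spec in Hr. destruct Hr; subst; exact Ls. }
    exists t; split; [exact Lt|]. apply (lev_potent t Lt s); [apply Ht, upair_spec; auto|exact Hs].
  - exists s; split; [exact Ls|exact Hs].
Qed.

Lemma lev_next s : lev s -> exists t, lev t /\ s ∈ t.
Proof.
  intros Ls. destruct (lev_above (upair s s)) as (t & Lt & Ht).
  - intros r Hr. apply upair_spec in Hr. destruct Hr; subst; exact Ls.
  - exists t; split; [exact Lt|apply Ht, upair_spec; auto].
Qed.
Lemma lev_ex x : exists s, lev s /\ x ∈ s.
Proof.
  destruct (lev_sub x) as (s & Ls & Hs). destruct (lev_next s Ls) as (t & Lt & Ht).
  exists t; split; [exact Lt|exact (lev_potent t Lt s x Ht Hs)].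
Qed.
Lemma lev_join s t : lev s -> lev t -> exists r, lev r /\ sub E s r /\ sub E t r /\ (r = s \/ r = t).
Proof.
  intros Ls Lt. destruct (lev_total s t Ls Lt) as [H|[H|H]].
  - exists t; repeat split; auto using sub_refl. exact (lev_trans t Lt s H).
  - subst; exists t; repeat split; auto using sub_refl.
  - exists s; repeat split; auto using sub_refl. exact (lev_trans s Ls t H).
Qed.

(** * Reflection *)

Fixpoint allin (Y : M) (n : nat) (P : (nat -> M) -> Prop) (v : nat -> M) : Prop :=
  match n with
  | 0 => P v
  | S n => forall x, x ∈ Y -> allin Y n P (x .: v)
  end.

Lemma allin_mono Y n (P Q : (nat -> M) -> Prop) : (forall v, P v -> Q v) ->
  forall v, allin Y n P v -> allin Y n Q v.
Proof.
  intros HPQ; induction n as [|n IH]; simpl; intros v; [apply HPQ|]. intros H x Hx; auto.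
Qed.

Lemma allin_iff Y n P : forall v, allin Y n P v <->
  forall xs, (forall i, i < n -> xs i ∈ Y) -> P (fun i => if i <? n then xs i else v (i - n)).
Proof.
  induction n as [|n IH]; intros v; simpl allin.
  - assert (K : v = fun i => v (i - 0)).
    { apply functional_extensionality; intros i; rewrite Nat.sub_0_r; reflexivity. }
    split; [intros H xs _; simpl; rewrite <- K; exact H|].
    intros H. rewrite K. apply (H v). intros i Hi; lia.
  - split.
    + intros H xs Hxs. specialize (H (xs n) (Hxs n (Nat.lt_succ_diag_r n))).
      rewrite IH in H. specialize (H xs (fun i Hi => Hxs i (Nat.lt_lt_succ_r _ _ Hi))).
      replace (fun i => if i <? S n then xs i else v (i - S n))
        with (fun i => if i <? n then xs i else (xs n .: v) (i - n)); [exact H|].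
      apply functional_extensionality; intros i.
      destruct (Nat.ltb_spec i n), (Nat.ltb_spec i (S n)); try lia; [reflexivity| |].
      * replace i with n by lia. rewrite Nat.sub_diag; reflexivity.
      * replace (i - n) with (S (i - S n)) by lia. reflexivity.
    + intros H x Hx. apply IH. intros xs Hxs.
      specialize (H (fun i => if i <? n then xs i else x)).
      match type of H with _ -> P ?a => match goal with |- P ?b => replace b with a end end.
      * apply H. intros i Hi. destruct (Nat.ltb_spec i n); auto.
      * apply functional_extensionality; intros i.
        destruct (Nat.ltb_spec i n), (Nat.ltb_spec i (S n)); try lia; [reflexivity| |].
        -- replace i with n by lia. rewrite Nat.sub_diag; reflexivity.
        -- replace (i - n) with (S (i - S n)) by lia. reflexivity.
Qed.

Lemma Df_allin C b n : forall (P : (nat -> M) -> (nat -> M) -> Prop) (t : (nat -> M) -> M) s,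
  (forall r s, (forall i, isTm C (fun v => r v i)) -> (forall i, isTm C (fun v => s v i)) ->
    Df E st C b (fun v => P (r v) (s v))) ->
  isTm C t -> (forall i, isTm C (fun v => s v i)) -> Df E st C b (fun v => allin (t v) n (P v) (s v)).
Proof.
  induction n as [|n IH]; intros P t s HP Ht Hs; simpl.
  - apply (HP (fun v => v) s); [apply TVar|exact Hs].
  - apply (DfAll E st C b (fun v x => x ∈ t v -> allin (t v) n (P v) (x .: s v))).
    assert (Ht' := isTm_shift C t Ht).
    apply DfImp; [apply DfMem; [apply (TVar 0)|exact Ht']|].
    apply (IH (fun v => P (fun i => v (S i))) (fun v => t (fun i => v (S i)))
      (fun v => v 0 .: s (fun i => v (S i)))).
    + intros r s' Hr Hs'. apply (HP (fun v i => r v (S i)) s'); [intros i; apply Hr|exact Hs'].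
    + exact Ht'.
    + intros [|i]; [apply (TVar 0)|]. apply (isTm_shift C (fun v => s v i)), Hs.
Qed.

Lemma allin_bound n : forall (P : M -> (nat -> M) -> Prop) Y v,
  (forall l s, isTm (fun _ => True) l -> (forall i, isTm (fun _ => True) (fun v => s v i)) ->
    DF (fun v => P (l v) (s v))) ->
  (forall s t w, lev s -> lev t -> s ∈ t -> P s w -> P t w) ->
  allin Y n (fun w => exists s, lev s /\ P s w) v -> exists s, lev s /\ allin Y n (P s) v.
Proof.
  induction n as [|n IH]; intros P Y v HP Hmono; simpl; [auto|]. intros H.
  apply (lev_bound (fun x s => allin Y n (P s) (x .: v))).
  - apply (Df_allin _ _ n (fun v => P (v 1)) (fun _ => Y) (fun w => w 0 .: v)).
    + intros r s Hr Hs. apply (HP (fun v => r v 1) s); auto.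
    + istm.
    + intros [|i]; istm.
  - intros x s t Ls Lt Hst. apply allin_mono. intros w; apply Hmono; auto.
  - intros x Hx. apply IH; auto.
Qed.

(* Every counterexample with parameters in [Y] to a universal subformula of [phi] can be found in
   [L]; [n] bounds the free variables of [phi], and [m0] is a dummy value for the others. *)
Fixpoint adq (Y L : M) (n : nat) (phi : form) : Prop :=
  match phi with
  | FImp p q => adq Y L n p /\ adq Y L n q
  | FAll p => adq Y L (S n) p /\
      allin Y n (fun w => (exists x, ~ sat0 (x .: w) p) -> exists x, x ∈ L /\ ~ sat0 (x .: w) p)
        (fun _ => m0)
  | _ => True
  end.

Lemma Df_adq_aux (C : M -> Prop) p (l : (nat -> M) -> M) s : internal p -> isTm C l ->
  (forall i, isTm C (fun v => s v i)) ->
  Df E st C true (fun v => (exists x, ~ sat0 (x .: s v) p) -> exists x, x ∈ l v /\ ~ sat0 (x .: s v) p).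
Proof.
  intros Hp Hl Hs.
  assert (K : Df E st C true (fun v => sat0 (v 0 .: s (fun i => v (S i))) p)).
  { apply (Df_subst E st C true (fun v => sat0 v p)) with (s := fun v => v 0 .: s (fun i => v (S i))).
    - apply Df_sat; [apply DfTrue|auto].
    - intros [|i]; [apply (TVar 0)|]. apply (isTm_shift C (fun v => s v i)), Hs. }
  apply DfImp; apply DfEx; [apply DfNot, K|]. apply DfAnd; [|apply DfNot, K].
  assert (Hl' := isTm_shift C l Hl). apply DfMem; [apply (TVar 0)|exact Hl'].
Qed.

Lemma Df_adq (C : M -> Prop) phi : C m0 -> internal phi -> forall n t l, isTm C t -> isTm C l ->
  Df E st C true (fun v => adq (t v) (l v) n phi).
Proof.
  intros Hm. induction phi as [i j|i j|i| |p IHp q IHq|p IHp]; simpl; intros Hp n t l Ht Hl;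
    try apply DfTrue.
  - destruct Hp. apply DfAnd; auto.
  - apply DfAnd; [auto|].
    destruct Hl as [j|c Hc].
    + apply (Df_allin C true n (fun v w => (exists x, ~ sat0 (x .: w) p) ->
        exists x, x ∈ v j /\ ~ sat0 (x .: w) p) t (fun _ _ => m0)).
      * intros r s Hr Hs. apply (Df_adq_aux C p (fun v => r v j) s); auto.
      * exact Ht.
      * intros i; istm.
    + apply (Df_allin C true n (fun v w => (exists x, ~ sat0 (x .: w) p) ->
        exists x, x ∈ c /\ ~ sat0 (x .: w) p) t (fun _ _ => m0)).
      * intros r s Hr Hs. apply (Df_adq_aux C p (fun v => c) s); auto. istm.
      * exact Ht.
      * intros i; istm.
Qed.

Lemma adq_mono Y L L' phi : sub E L L' -> forall n, adq Y L n phi -> adq Y L' n phi.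
Proof.
  intros H; induction phi as [i j|i j|i| |p IHp q IHq|p IHp]; simpl; intros n; auto.
  - intros [K1 K2]; auto.
  - intros [K1 K2]; split; [auto|]. revert K2. apply allin_mono.
    intros v K Hx. destruct (K Hx) as (x & Hx' & Kx); eauto.
Qed.

Lemma adq_exists Y phi : internal phi -> forall n, exists L, lev L /\ adq Y L n phi.
Proof.
  induction phi as [i j|i j|i| |p IHp q IHq|p IHp]; simpl; intros Hi n;
    try (destruct (lev_ex m0) as (L & HL & _); exists L; split; [exact HL|exact I]).
  - destruct Hi as [Hp Hq]. destruct (IHp Hp n) as (L1 & HL1 & A1). destruct (IHq Hq n) as (L2 & HL2 & A2).
    destruct (lev_join L1 L2 HL1 HL2) as (L & HL & S1 & S2 & _). exists L; split; [exact HL|].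
    split; [exact (adq_mono Y L1 L p S1 n A1)|exact (adq_mono Y L2 L q S2 n A2)].
  - destruct (IHp Hi (S n)) as (L1 & HL1 & A1).
    destruct (allin_bound n (fun L w => (exists x, ~ sat0 (x .: w) p) ->
      exists x, x ∈ L /\ ~ sat0 (x .: w) p) Y (fun _ => m0)) as (L2 & HL2 & A2).
    + intros l s Hl Hs. apply Df_adq_aux; auto.
    + intros s t w Ls Lt Hst H Hx. destruct (H Hx) as (x & Hxs & K).
      exists x; split; [exact (lev_trans t Lt s Hst x Hxs)|exact K].
    + apply allin_iff. intros xs _. cbv beta.
      match goal with |- exists s, lev s /\ ((exists x, ~ sat0 (x .: ?w) p) -> _) => set (v := w) end.
      destruct (classic (exists x, ~ sat0 (x .: v) p)) as [[x Hx]|Hn].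
      * destruct (lev_ex x) as (L & HL & HxL). exists L; split; [exact HL|]. eauto.
      * exists L1; split; [exact HL1|]. intros H; contradiction.
    + destruct (lev_join L1 L2 HL1 HL2) as (L & HL & S1 & S2 & _). exists L; split; [exact HL|].
      split; [exact (adq_mono Y L1 L p S1 (S n) A1)|]. revert A2. apply allin_mono.
      intros w H Hx. destruct (H Hx) as (x & Hxs & K); eauto.
Qed.

Lemma lev_family_bound u W n (xs : nat -> M) : (forall L, L ∈ u -> lev L) -> (exists L, L ∈ u) ->
  (forall x, x ∈ W <-> exists Y, x ∈ Y /\ Y ∈ u) ->
  (forall i, i < n -> xs i ∈ W) -> exists Y, Y ∈ u /\ forall i, i < n -> xs i ∈ Y.
Proof.
  intros Hu Hne HW. induction n as [|n IH]; intros Hxs.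
  - destruct Hne as [L HL]. exists L; split; [exact HL|]. intros i Hi; lia.
  - destruct IH as (Y & HY & K); [auto|].
    destruct (proj1 (HW (xs n)) (Hxs n (Nat.lt_succ_diag_r n))) as (Z & HnZ & HZ).
    destruct (lev_join Y Z (Hu Y HY) (Hu Z HZ)) as (L & HL & S1 & S2 & H).
    exists L; split; [destruct H; subst; assumption|].
    intros i Hi. destruct (Nat.eq_dec i n) as [->|Hin]; [apply S2, HnZ|apply S1, K; lia].
Qed.

Lemma adq_limit u W : (forall L, L ∈ u -> lev L) -> (exists L, L ∈ u) ->
  (forall x, x ∈ W <-> exists Y, x ∈ Y /\ Y ∈ u) ->
  forall phi n, (forall Y, Y ∈ u -> exists L, L ∈ u /\ adq Y L n phi) -> adq W W n phi.
Proof.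
  intros Hu Hne HW phi; induction phi as [i j|i j|i| |p IHp q IHq|p IHp]; simpl; intros n H; auto.
  - split; [apply IHp|apply IHq]; intros Y HY; destruct (H Y HY) as (L & HL & A1 & A2); eauto.
  - split.
    + apply IHp. intros Y HY; destruct (H Y HY) as (L & HL & A1 & A2); eauto.
    + apply allin_iff. intros xs Hxs Hx.
      destruct (lev_family_bound u W n xs) as (Y & HY & K); auto.
      destruct (H Y HY) as (L & HL & _ & A). rewrite allin_iff in A.
      destruct (A xs K Hx) as (x & HxL & Hn). exists x; split; [apply HW; eauto|exact Hn].
Qed.

Lemma adq_reflects W phi : forall n, adq W W n phi -> bounded n phi -> internal phi ->
  forall w, (forall i, w i ∈ W) -> (sat E st (fun x => x ∈ W) w phi <-> sat0 w phi).
Proof.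
  induction phi as [i j|i j|i| |p IHp q IHq|p IHp]; simpl; intros n HA Hb Hi w Hw; try tauto.
  - destruct HA, Hb, Hi. rewrite (IHp n), (IHq n); tauto.
  - destruct HA as [A1 A2].
    assert (K : forall x, x ∈ W -> (sat E st (fun x => x ∈ W) (x .: w) p <-> sat0 (x .: w) p)).
    { intros x Hx. apply (IHp (S n)); auto. intros [|i]; simpl; auto. }
    split.
    + intros H x _. apply NNPP; intros Hx. rewrite allin_iff in A2.
      assert (Hs : forall x, sat0 (x .: (fun i => if i <? n then w i else m0)) p <-> sat0 (x .: w) p).
      { intros y. apply sat_bounded with (S n); [exact Hb|]. intros [|i] Hin; simpl; [reflexivity|].
        destruct (Nat.ltb_spec i n); [reflexivity|lia]. }
      destruct (A2 w) as (y & Hy & Hny); [auto| |].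
      * exists x. rewrite Hs. exact Hx.
      * rewrite Hs in Hny. apply Hny, K, H; exact Hy.
    + intros H x Hx. apply K; auto.
Qed.

Definition nice W := trans W /\ potent W /\
  (forall x y, x ∈ W -> y ∈ W -> exists Y, Y ∈ W /\ x ∈ Y /\ y ∈ Y /\ trans Y /\ potent Y) /\
  exists x, x ∈ W.

Lemma nice_op W a b : nice W -> a ∈ W -> b ∈ W -> op a b ∈ W.
Proof.
  intros (HT & HP & HV & _).
  assert (K : forall a b, a ∈ W -> b ∈ W -> upair a b ∈ W).
  { intros c d Hc Hd. destruct (HV c d Hc Hd) as (Y & HY & H1 & H2 & _).
    apply (HP Y); [exact HY|]. intros z Hz; apply upair_spec in Hz. destruct Hz; subst; assumption. }
  intros Ha Hb; unfold op; auto.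
Qed.

Lemma nice_insert W A x B : nice W -> A ∈ W -> x ∈ W -> (forall z, z ∈ B -> z ∈ A \/ z = x) -> B ∈ W.
Proof.
  intros (HT & HP & HV & _) HA Hx HB. destruct (HV A x HA Hx) as (Y & HY & HAY & HxY & HTY & _).
  apply (HP Y); [exact HY|]. intros z Hz. destruct (HB z Hz) as [H| ->]; [|exact HxY].
  exact (HTY A HAY z H).
Qed.

Lemma nice_graph W A B f : nice W -> A ∈ W -> B ∈ W ->
  (forall p, p ∈ f -> exists a b, a ∈ A /\ b ∈ B /\ p = op a b) -> f ∈ W.
Proof.
  intros (HT & HP & HV & _) HA HB Hf. destruct (HV A B HA HB) as (Y1 & H1 & HA1 & HB1 & T1 & P1).
  destruct (HV Y1 Y1 H1 H1) as (Y2 & H2 & H12 & _ & T2 & P2).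
  destruct (HV Y2 Y2 H2 H2) as (Y3 & H3 & H23 & _ & T3 & P3).
  apply (HP Y3); [exact H3|]. intros p Hp. destruct (Hf p Hp) as (a & b & Ha & Hb & ->).
  apply (P3 Y2); [exact H23|]. intros z Hz. unfold op in Hz; apply upair_spec in Hz.
  apply (P2 Y1); [exact H12|]. intros w Hw.
  destruct Hz; subst z; apply upair_spec in Hw; destruct Hw; subst w;
    first [exact (T1 A HA1 a Ha)|exact (T1 B HB1 b Hb)].
Qed.

Section Hierarchy.
Context (phi : form) (Hphi : internal phi) (n : nat).

Definition captures Y L := Y ∈ L /\ adq Y L n phi.
Definition above u L := forall Y, Y ∈ u -> captures Y L.
Definition next u L := least (above u) L.

Lemma Df_captures : DF (fun v => captures (v 0) (v 1)).
Proof. apply DfAnd; [df|]. apply Df_adq; auto; apply TVar. Qed.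

Lemma Df_next : DF (fun v => next (v 0) (v 1)).
Proof.
  assert (HL := Df_lev (fun _ => True) true). assert (HA := Df_captures).
  unfold next, least, above. df.
Qed.

Lemma next_tot u : exists L, next u L.
Proof.
  assert (HA := Df_captures).
  assert (H : exists L, lev L /\ above u L).
  { apply (lev_bound captures).
    - exact HA.
    - intros x s t Ls Lt Hst [H1 H2]; split; [exact (lev_trans t Lt s Hst x H1)|].
      exact (adq_mono x s t phi (lev_trans t Lt s Hst) n H2).
    - intros Y _. destruct (lev_ex Y) as (s & Ls & Hs). destruct (adq_exists Y phi Hphi n) as (t & Lt & Ht).
      destruct (lev_join s t Ls Lt) as (r & Lr & S1 & S2 & _). exists r; split; [exact Lr|].
      split; [apply S1, Hs|exact (adq_mono Y t r phi S2 n Ht)]. }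
  destruct (lev_min (above u)) as [L HL]; [|exact H|exists L; exact HL].
  unfold above; df.
Qed.

Lemma hierarchy I R : DF (fun v => R (v 0) (v 1)) ->
  (forall U, (forall x, x ∈ U -> x ∈ I) -> (exists x, x ∈ U) ->
    exists m, m ∈ U /\ forall y, y ∈ U -> ~ R y m) ->
  (exists a, a ∈ I) -> (forall a, a ∈ I -> exists b, b ∈ I /\ R a b) ->
  exists X : M -> M -> Prop, DF (fun v => X (v 0) (v 1)) /\
    (forall a, a ∈ I -> exists y, X a y) /\
    (forall a y y', X a y -> X a y' -> y = y') /\
    (forall a y, X a y -> a ∈ I /\ trans y) /\
    (forall a b y z, X a y -> X b z -> R a b -> y ∈ z) /\
    exists W, (forall x, x ∈ W <-> exists a y, X a y /\ x ∈ y) /\ nice W /\ adq W W n phi.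
Proof.
  intros HR wf Hne Hub. assert (HG := Df_next).
  assert (Gfun : forall u y y', next u y -> next u y' -> y = y') by (intros u y y'; apply least_unique).
  pose (X := rec I R next).
  assert (HX : DF (fun v => X (v 0) (v 1))) by exact (Df_rec I R next HR HG).
  assert (Xtot := rec_tot I R next HR HG wf next_tot Gfun). fold X in Xtot.
  assert (Xfun := rec_fun I R next HR HG wf Gfun). fold X in Xfun.
  assert (Xeq := rec_eq I R next HR HG wf Gfun). fold X in Xeq.
  assert (Xlev : forall a y, X a y -> lev y).
  { intros a y Hy. destruct (Xeq a y Hy) as (u & (L & _) & _); exact L. }
  assert (Xstep : forall a b y z, X a y -> X b z -> R a b -> y ∈ z /\ adq y z n phi).
  { intros a b y z Hy Hz Hr. destruct (Xeq b z Hz) as (u & (_ & A & _) & Hu). apply A, Hu.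
    exists a; split; [exact (rec_dom I R next a y Hy)|auto]. }
  exists X. split; [exact HX|]. split; [exact Xtot|]. split; [exact Xfun|].
  split; [intros a y Hy; split; [exact (rec_dom I R next a y Hy)|exact (lev_trans y (Xlev a y Hy))]|].
  split; [intros a b y z Hy Hz Hr; exact (proj1 (Xstep a b y z Hy Hz Hr))|].
  destruct (replacement X HX I) as [u Hu]; [exact Xtot|intros a y y' _; apply Xfun|].
  destruct (union_exists u) as [W HW].
  assert (Hulev : forall L, L ∈ u -> lev L).
  { intros L HL; apply Hu in HL. destruct HL as (a & _ & HL); eauto. }
  assert (Hune : exists L, L ∈ u).
  { destruct Hne as [a Ha]. destruct (Xtot a Ha) as [y Hy]. exists y; apply Hu; eauto. }
  assert (Hustep : forall Y, Y ∈ u -> exists L, L ∈ u /\ Y ∈ L /\ adq Y L n phi).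
  { intros Y HY. apply Hu in HY. destruct HY as (a & Ha & HY). destruct (Hub a Ha) as (b & Hb & Hr).
    destruct (Xtot b Hb) as [z Hz]. exists z. split; [apply Hu; eauto|]. exact (Xstep a b Y z HY Hz Hr). }
  assert (HuW : forall Y, Y ∈ u -> Y ∈ W).
  { intros Y HY. destruct (Hustep Y HY) as (L & HL & HYL & _). apply HW; eauto. }
  exists W. split; [|split].
  - intros x. rewrite HW. split.
    + intros (Y & Hx & HY). apply Hu in HY. destruct HY as (a & _ & HY). eauto.
    + intros (a & y & Hy & Hx). exists y; split; [exact Hx|]. apply Hu. exists a; split; [|exact Hy].
      exact (rec_dom I R next a y Hy).
  - split; [|split; [|split]].
    + intros y Hy x Hx. apply HW in Hy. destruct Hy as (Y & HyY & HY). apply HW. exists Y.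
      split; [exact (lev_trans Y (Hulev Y HY) y HyY x Hx)|exact HY].
    + intros y x Hy Hx. apply HW in Hy. destruct Hy as (Y & HyY & HY). apply HW. exists Y.
      split; [exact (lev_potent Y (Hulev Y HY) y x HyY Hx)|exact HY].
    + intros x y Hx Hy.
      destruct (lev_family_bound u W 2 (x .: y .: fun _ => x)) as (Y & HY & K); auto.
      { intros [|[|i]] Hi; simpl; auto. }
      exists Y. split; [auto|]. split; [apply (K 0); lia|]. split; [apply (K 1); lia|].
      split; [exact (lev_trans Y (Hulev Y HY))|exact (lev_potent Y (Hulev Y HY))].
    + destruct Hune as [L HL]. exists L; auto.
  - apply (adq_limit u); auto. intros Y HY. destruct (Hustep Y HY) as (L & HL & _ & A); eauto.
Qed.
End Hierarchy.

Lemma nice_ind W n phi : nice W -> adq W W n (FImp ax_inf phi) -> exists I, I ∈ W /\ ind E I.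
Proof.
  intros (_ & _ & _ & w & Hw) [H _].
  assert (Hs : forall x v, sat0 (x .: v) (bInd 0 1) <-> ind E x) by sem.
  destruct H as [[_ H] _]. rewrite allin_iff in H.
  destruct (H (fun _ => w)) as (x & Hx & K).
  - auto.
  - destruct infinity as [I HInd]. exists I. intros K; apply K, Hs, HInd.
  - exists x; split; [exact Hx|]. apply NNPP; intros Hn. apply K.
    intros L. apply Hn. revert L. apply Hs.
Qed.

(** * Limit levels of countable and uncountable cofinality *)

Lemma short_limit phi n : internal phi -> exists W g, nice W /\ adq W W n phi /\ funN E g /\
  (forall k v, app E g k v -> v ∈ W) /\ ~ g ∈ W.
Proof.
  intros Hphi. destruct omega_exists as [o Ho].
  destruct (hierarchy phi Hphi n o E) as (X & HX & Xtot & Xfun & Xdom & Xstep & W & HW & Hnice & HA).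
  - df.
  - apply wf_mem.
  - destruct empty_exists as [e He]. exists e; apply Ho, nat_empty, He.
  - intros k Hk. destruct (issucc_exists k) as [s Hs]. exists s. apply Ho in Hk.
    split; [apply Ho, (nat_succ k); auto|apply Hs; auto].
  - destruct (replacement (fun k q => exists y, X k y /\ pair E k y q)) with (A := o) as [g Hg].
    + df.
    + intros k Hk. destruct (Xtot k Hk) as [y Hy]. exists (op k y), y.
      split; [exact Hy|apply pair_op; reflexivity].
    + intros k q q' _ (y & Hy & Hq) (y' & Hy' & Hq'). apply pair_op in Hq, Hq'. subst.
      rewrite (Xfun k y y'); auto.
    + assert (App : forall k y, app E g k y <-> X k y).
      { intros k y. rewrite app_op, Hg. split.
        - intros (c & _ & z & Hz & Hq). apply pair_op, op_inj in Hq. destruct Hq; subst; exact Hz.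
        - intros Hy. exists k. split; [apply (Xdom k y Hy)|].
          exists y; split; [exact Hy|apply pair_op; reflexivity]. }
      exists W, g. split; [exact Hnice|]. split; [exact HA|]. split; [split; [split|]|split].
      * intros p Hp. apply Hg in Hp. destruct Hp as (k & _ & y & _ & Hp). eauto.
      * intros a b b'. rewrite !App. intros [H1 H2]; eauto.
      * intros a. split.
        -- intros [b Hb]. apply App in Hb. apply Ho, (Xdom a b Hb).
        -- intros Ha. apply Ho in Ha. destruct (Xtot a Ha) as [y Hy]. exists y; apply App, Hy.
      * intros k v Hv. apply App in Hv. destruct (issucc_exists k) as [s Hs].
        assert (Hk := proj1 (Xdom k v Hv)). apply Ho in Hk.
        destruct (Xtot s) as [z Hz]; [apply Ho, (nat_succ k); auto|].
        apply HW. exists s, z. split; [exact Hz|]. apply (Xstep k s v z Hv Hz), Hs; auto.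
      * intros Hg'. apply HW in Hg'. destruct Hg' as (a & y & Hy & Hgy).
        assert (T := proj2 (Xdom a y Hy)).
        assert (H1 : op a y ∈ y) by (apply (T g Hgy), app_op, App, Hy).
        assert (H2 : upair a y ∈ y) by (apply (T _ H1); unfold op; apply upair_spec; auto).
        apply (mem_irrefl y), (T _ H2), upair_spec; auto.
Qed.

Section CountablyDirected.
Context (Z z0 P D : M).
Definition nonempty x := exists z, z ∈ x.
(* [e] codes the sequence of the sets [{z | (k, z) ∈ e}], its immediate predecessors being the
   nonempty ones. *)
Definition pred d e := nonempty d /\ exists k, isnat E k /\ forall z, z ∈ d <-> exists p, p ∈ e /\ pair E k z p.
Definition progressive U := forall y, y ∈ P -> nonempty y ->
  (forall d, d ∈ P -> pred d y -> d ∈ U) -> y ∈ U.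
Context (HZ : forall k z, isnat E k -> z ∈ Z -> op k z ∈ Z) (Hz0 : z0 ∈ Z) (Hz0e : empty E z0).
Context (HP : forall x, x ∈ P <-> sub E x Z).
Context (HD : forall x, x ∈ D <-> x ∈ P /\ nonempty x /\ forall U, progressive U -> x ∈ U).

Lemma Df_pred : DF (fun v => pred (v 0) (v 1)).
Proof. unfold pred, nonempty. df. Qed.

Lemma pred_wf U : (forall x, x ∈ U -> x ∈ D) -> (exists x, x ∈ U) ->
  exists m, m ∈ U /\ forall y, y ∈ U -> ~ pred y m.
Proof.
  intros HU (e & He). apply NNPP; intros Hn.
  destruct (separation (fun x => ~ x ∈ U)) with (x := P) as [V HV]; [df|].
  assert (K : progressive V).
  { intros y Hy Hne Hpred. apply HV; split; [exact Hy|]. intros HyU. apply Hn.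
    exists y; split; [exact HyU|]. intros d Hd Hdy.
    assert (HdP := proj1 (proj1 (HD d) (HU d Hd))).
    specialize (Hpred d HdP Hdy). apply HV in Hpred. tauto. }
  assert (H := proj2 (proj2 (proj1 (HD e) (HU e He))) V K). apply HV in H. tauto.
Qed.

Lemma mem_D e : sub E e Z -> nonempty e -> (forall d, pred d e -> d ∈ D) -> e ∈ D.
Proof.
  intros He Hne Hpred. apply HD. split; [apply HP, He|split; [exact Hne|]].
  intros U HU. apply HU; [apply HP, He|exact Hne|]. intros d _ Hd.
  apply (proj1 (HD d) (Hpred d Hd)), HU.
Qed.

Lemma D_nonempty : exists a, a ∈ D.
Proof.
  exists (upair z0 z0). apply mem_D.
  - intros z Hz. apply upair_spec in Hz. destruct Hz; subst; exact Hz0.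
  - exists z0; apply upair_spec; auto.
  - intros d ((z & Hz) & k & _ & Hd). apply Hd in Hz. destruct Hz as (p & Hp & Hpair).
    apply pair_op in Hpair. subst p. exfalso. apply (Hz0e (upair k k)).
    assert (op k z = z0) as <- by (apply upair_spec in Hp; tauto).
    unfold op; apply upair_spec; auto.
Qed.

(* Countable subsets of [D] are bounded, since the code of a sequence in [D] is again in [D]. *)
Lemma D_sequence (S : M -> M -> Prop) : DF (fun v => S (v 0) (v 1)) ->
  (exists k d, isnat E k /\ S k d) -> (forall k d d', S k d -> S k d' -> d = d') ->
  (forall k d, S k d -> d ∈ D) ->
  exists e, e ∈ D /\ forall k d, isnat E k -> S k d -> pred d e.
Proof.
  intros HS (k0 & d0 & Hk0 & Hd0) Sfun SD.
  destruct (separation (fun p => exists k d z, isnat E k /\ S k d /\ z ∈ d /\ pair E k z p))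
    with (x := Z) as [e He]; [df|].
  assert (Hep : forall k d z, isnat E k -> S k d -> (z ∈ d <-> exists p, p ∈ e /\ pair E k z p)).
  { intros k d z Hk Hd. split.
    - intros Hz. exists (op k z). split; [|apply pair_op; reflexivity]. apply He. split.
      + apply HZ; [exact Hk|]. apply SD, HD in Hd. destruct Hd as [Hd _]. apply HP in Hd. exact (Hd z Hz).
      + exists k, d, z. repeat apply conj; auto. apply pair_op; reflexivity.
    - intros (p & Hp & Hpair). apply pair_op in Hpair. subst p. apply He in Hp.
      destruct Hp as (_ & k' & d' & z' & _ & Hd' & Hz' & Hpair).
      apply pair_op, op_inj in Hpair. destruct Hpair; subst k' z'. rewrite (Sfun k d d'); auto. }
  assert (Hpred : forall k d, isnat E k -> S k d -> pred d e).
  { intros k d Hk Hd. split; [apply (proj1 (HD d)), (SD k d Hd)|]. exists k; split; [exact Hk|].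
    intros z; apply Hep; auto. }
  exists e. split; [|exact Hpred]. apply mem_D.
  - intros z Hz; apply He in Hz; tauto.
  - destruct (proj1 (proj2 (proj1 (HD d0) (SD k0 d0 Hd0)))) as [z Hz].
    apply (Hep k0 d0 z Hk0 Hd0) in Hz. destruct Hz as (p & Hp & _). exists p; exact Hp.
  - intros d ((z & Hz) & k & Hk & Hd). assert (H := Hz). apply Hd in H. destruct H as (p & Hp & Hpair).
    apply pair_op in Hpair. subst p. apply He in Hp.
    destruct Hp as (_ & k' & d' & z' & _ & Hd' & _ & Hpair).
    apply pair_op, op_inj in Hpair. destruct Hpair; subst k' z'.
    replace d with d'; [exact (SD k d' Hd')|]. apply ext; intros w. rewrite Hd. apply Hep; auto.
Qed.
End CountablyDirected.

Lemma countable_choice D (S : M -> M -> Prop) : DF (fun v => S (v 0) (v 1)) ->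
  (forall k, isnat E k -> exists d, d ∈ D /\ S k d) ->
  exists f : M -> M -> Prop, DF (fun v => f (v 0) (v 1)) /\
    (forall k, isnat E k -> exists d, f k d) /\ (forall k d d', f k d -> f k d' -> d = d') /\
    (forall k d, f k d -> d ∈ D /\ S k d).
Proof.
  intros HS Htot. destruct omega_exists as [o Ho].
  pose (Q := fun k q => forall p, p ∈ q <-> exists d, d ∈ D /\ S k d /\ pair E k d p).
  assert (HQ : DF (fun v => Q (v 0) (v 1))) by (unfold Q; df).
  assert (Qtot : forall k, exists q, Q k q).
  { intros k. destruct (separation (S k)) with (x := D) as [A HA]; [df|].
    destruct (replacement (pair E k)) with (A := A) as [q Hq].
    - df.
    - intros d _. exists (op k d). apply pair_op; reflexivity.
    - intros d y y' _ H1 H2. apply pair_op in H1, H2. congruence.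
    - exists q. intros p. rewrite Hq. split; intros (d & Hd); exists d; rewrite HA in *; tauto. }
  destruct (replacement Q HQ o) as [F HF].
  { intros k _; apply Qtot. }
  { intros k q q' _ H1 H2. apply ext; intros p. rewrite (H1 p), (H2 p); tauto. }
  destruct (choice_set F) as [C HC].
  { split.
    - intros q Hq. apply HF in Hq. destruct Hq as (k & Hk & Hq). apply Ho in Hk.
      destruct (Htot k Hk) as (d & Hd & HSd). exists (op k d). apply Hq. exists d.
      repeat apply conj; auto. apply pair_op; reflexivity.
    - intros q q' (Hq & Hq' & Hne) (p & Hp & Hp'). apply Hne.
      apply HF in Hq, Hq'. destruct Hq as (k & _ & Hq). destruct Hq' as (k' & _ & Hq').
      apply Hq in Hp. apply Hq' in Hp'. destruct Hp as (d & _ & _ & H1). destruct Hp' as (d' & _ & _ & H2).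
      apply pair_op in H1, H2. rewrite H1 in H2. apply op_inj in H2. destruct H2 as [<- _].
      apply ext; intros p'. rewrite (Hq p'), (Hq' p'); tauto. }
  exists (fun k d => isnat E k /\ d ∈ D /\ S k d /\ exists p, p ∈ C /\ pair E k d p).
  split; [df|]. split; [|split].
  - intros k Hk. destruct (Qtot k) as [q Hq].
    destruct (HC q) as (c & Hc & HcC & _); [apply HF; exists k; split; [apply Ho|]; assumption|].
    apply Hq in Hc. destruct Hc as (d & Hd & HSd & Hpair). exists d. eauto 7.
  - intros k d d' (Hk & Hd & HSd & p & Hp & Hpair) (_ & Hd' & HSd' & p' & Hp' & Hpair').
    destruct (Qtot k) as [q Hq].
    destruct (HC q) as (c & _ & _ & Hc); [apply HF; exists k; split; [apply Ho|]; assumption|].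
    assert (K1 : p = c) by (apply Hc; split; [apply Hq; eauto|exact Hp]).
    assert (K2 : p' = c) by (apply Hc; split; [apply Hq; eauto|exact Hp']).
    apply pair_op in Hpair, Hpair'. rewrite Hpair in K1. rewrite Hpair', <- K1 in K2.
    apply op_inj in K2. intuition congruence.
  - tauto.
Qed.

Lemma ind_nat I k : ind E I -> isnat E k -> k ∈ I.
Proof. intros HInd Hk; exact (Hk I HInd). Qed.

Lemma long_limit phi n : internal phi -> exists W, nice W /\ adq W W n (FImp ax_inf phi) /\
  forall G, funN E G -> (forall k v, app E G k v -> v ∈ W) -> G ∈ W.
Proof.
  intros Hphi.
  assert (Hinf : internal ax_inf) by (cbv; tauto).
  destruct (short_limit (FImp ax_inf FBot) 0) as (Z & _ & HZ & HAZ & _); [simpl; auto|].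
  destruct (nice_ind Z 0 FBot HZ HAZ) as (I0 & HI0 & Ind0).
  destruct empty_exists as [z0 Hz0].
  assert (Hnat0 : forall k, isnat E k -> k ∈ Z).
  { intros k Hk. apply (proj1 HZ I0 HI0), Hk, Ind0. }
  destruct (power_exists Z) as [P HP].
  destruct (separation (fun x => nonempty x /\ forall U, progressive P U -> x ∈ U)) with (x := P)
    as [D HD]; [unfold progressive, pred, nonempty; df|].
  assert (Hop : forall k z, isnat E k -> z ∈ Z -> op k z ∈ Z) by (intros; apply nice_op; auto).
  assert (Hseq := D_sequence Z P D Hop HP HD).
  destruct (hierarchy (FImp ax_inf phi) (conj Hinf Hphi) n D pred)
    as (X & HX & Xtot & Xfun & Xdom & Xstep & W & HW & Hnice & HA).
  - exact Df_pred.
  - exact (pred_wf P D HD).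
  - exact (D_nonempty Z z0 P D (Hnat0 z0 (nat_empty z0 Hz0)) Hz0 HP HD).
  - intros a Ha. destruct (Hseq (fun k d => k = z0 /\ d = a)) as (e & He & Hpred).
    + df.
    + exists z0, a. repeat split; auto using nat_empty.
    + intros k d d' [_ ->] [_ ->]; reflexivity.
    + intros k d [_ ->]; exact Ha.
    + exists e; split; [exact He|]. apply (Hpred z0); auto using nat_empty.
  - exists W. split; [exact Hnice|]. split; [exact HA|]. intros G [[HG1 HG2] HG3] HGW.
    destruct (countable_choice D (fun k d => exists v y, app E G k v /\ X d y /\ v ∈ y))
      as (f & Hf & Ftot & Ffun & FS).
    + df.
    + intros k Hk. apply HG3 in Hk. destruct Hk as [v Hv].
      assert (HvW := HGW k v Hv). apply HW in HvW. destruct HvW as (d & y & Hy & Hvy).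
      exists d. split; [apply (Xdom d y Hy)|eauto].
    + destruct (Hseq f Hf) as (e & He & Hpred).
      * assert (H0 := nat_empty z0 Hz0). destruct (Ftot z0 H0) as [d Hd]. eauto.
      * exact Ffun.
      * intros k d Hd; apply (FS k d Hd).
      * destruct (Xtot e He) as [Y HY].
        assert (HGY : forall k v, app E G k v -> v ∈ Y).
        { intros k v Hv. assert (Hk : isnat E k) by (apply HG3; eauto).
          destruct (Ftot k Hk) as [d Hd]. destruct (FS k d Hd) as (_ & v' & y & Hv' & Hy & Hvy).
          rewrite (HG2 k v v' (conj Hv Hv')).
          apply (proj2 (Xdom e Y HY) y); [|exact Hvy]. exact (Xstep d e y Y Hy HY (Hpred k d Hk Hd)). }
        assert (HYW : Y ∈ W).
        { destruct (Hseq (fun k d => k = z0 /\ d = e)) as (e' & He' & Hpred').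
          - df.
          - exists z0, e. repeat split; auto using nat_empty.
          - intros k d d' [_ ->] [_ ->]; reflexivity.
          - intros k d [_ ->]; exact He.
          - destruct (Xtot e' He') as [Y' HY']. apply HW. exists e', Y'. split; [exact HY'|].
            apply (Xstep e e' Y Y' HY HY'), (Hpred' z0); auto using nat_empty. }
        destruct (nice_ind W n phi Hnice HA) as (I & HIW & HInd).
        apply (nice_graph W I Y); auto. intros p Hp. destruct (HG1 p Hp) as (a & b & Hab).
        assert (Hap : app E G a b) by (exists p; auto).
        exists a, b. split; [|split; [eauto|apply pair_op, Hab]].
        apply ind_nat; [exact HInd|]. apply HG3; eauto.
Qed.

(** * Limit levels as models of IST *)

Context (Hm0 : st m0).

Lemma transfer (P : M -> Prop) : Df E st st true (fun v => P (v 0)) ->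
  (exists x, P x) -> exists x, st x /\ P x.
Proof.
  intros HP (x & Hx).
  destruct (Df_form1 E st st true P m0 Hm0 HP) as (f & p & Hf & Hp & Hs).
  destruct (bounded_exists f) as [n Hn].
  assert (H := HI _ (ITransfer n f (Hf eq_refl) (bounded_mono f n (S n) (Nat.le_succ_diag_r n) Hn)) p).
  assert (K : sat0 p (stconj n)).
  { clear - Hp. induction n as [|n IH]; [simpl; tauto|]. apply sat_FAnd; split; [apply Hp|exact IH]. }
  specialize (H K). change (sat0 p (FEx f) -> sat0 p (FEx (FAnd (FSt 0) f))) in H.
  rewrite !sat_FEx in H. destruct H as (y & _ & H).
  - exists x; split; [exact I|apply Hs, Hx].
  - apply sat_FAnd in H. exists y; split; [apply H|apply Hs, H].
Qed.

Lemma transfer_all (P : M -> Prop) : Df E st st true (fun v => P (v 0)) ->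
  (forall x, st x -> P x) -> forall x, P x.
Proof.
  intros HP H x. apply NNPP; intros Hx.
  destruct (transfer (fun x => ~ P x)) as (y & Hy & Hn); [df|eauto|auto].
Qed.

Ltac by_transfer := lazymatch goal with |- forall x, @?P x => apply (transfer_all P) end.

Lemma st_op a b : st a -> st b -> st (op a b).
Proof.
  intros Ha Hb. destruct (transfer (pair E a b)) as (p & Hp & H); [df| |].
  - exists (op a b); apply pair_op; reflexivity.
  - apply pair_op in H; subst; exact Hp.
Qed.

Lemma idealization (P : M -> M -> Prop) : DF (fun v => P (v 0) (v 1)) ->
  (forall A, st A /\ fin E A -> exists x, forall a, a ∈ A -> P x a) <->
  exists x, forall a, st a -> P x a.
Proof.
  intros HP. destruct (Df_form2 E st _ true P m0 I HP) as (f & p & Hf & _ & Hs).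
  assert (H := HI _ (IIdeal f (Hf eq_refl)) p).
  match goal with |- ?G => assert (K : sat0 p (ax_ideal f) <-> G); [|tauto] end.
  sem; rewrite sat_emb; [rewrite <- (Hs x0 x1)|rewrite <- (Hs x x0)].
  all: match goal with |- sat _ _ _ ?a _ <-> sat _ _ _ ?b _ => replace a with b; [tauto|] end.
  all: apply functional_extensionality; intros [|[|i]]; simpl; rewrite ?Nat.sub_0_r; reflexivity.
Qed.

Lemma standardization (P : M -> Prop) : Df E st (fun _ => True) false (fun v => P (v 0)) ->
  forall X, st X -> exists Y, st Y /\ forall x, st x -> (x ∈ Y <-> x ∈ X /\ P x).
Proof.
  intros HP. destruct (Df_form1 E st _ false P m0 I HP) as (f & p & _ & _ & Hs).
  assert (H := HI _ (IStand f) p).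
  match goal with |- ?G => assert (K : sat0 p (ax_stand f) <-> G); [|tauto] end.
  sem; rewrite sat_emb, <- (Hs x1).
  match goal with |- sat _ _ _ ?a _ <-> sat _ _ _ ?b _ => replace a with b; [tauto|] end.
  apply functional_extensionality; intros [|i]; simpl; rewrite ?Nat.sub_0_r; reflexivity.
Qed.

Fixpoint refl_list (l : list form) : form :=
  match l with [] => FBot | p :: l => FImp p (refl_list l) end.

Definition helpers : list form := [bNat 0 1; bApp 0 1 2 3; bFunOnNat 0 1; bFin 0 1].

Section LimitModel.
Context (l : list form) (n : nat) (W : M).
Context (Hl : forall p, In p l -> internal p) (Hhelp : forall p, In p helpers -> In p l).
Context (Hb : bounded n (refl_list l)).
Context (HW : st W) (Hnice : nice W) (HA : adq W W n (FImp ax_inf (refl_list l))).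
Notation satW := (sat E st (fun x => x ∈ W)).

Lemma reflects p : In p l -> forall w, (forall i, w i ∈ W) -> (satW w p <-> sat0 w p).
Proof.
  intros Hp. destruct HA as [_ HA']. clear HA Hhelp.
  induction l as [|q l' IH]; [destruct Hp|]. simpl in *.
  destruct Hb, HA'. destruct Hp as [->|Hp]; [|apply IH; auto].
  apply (adq_reflects W p n); auto.
Qed.

Lemma satW_nat w : (forall i, w i ∈ W) -> (satW w (bNat 0 1) <-> isnat E (w 0)).
Proof. intros Hw. rewrite reflects; [sem|apply Hhelp; simpl; auto|exact Hw]. Qed.
Lemma satW_fun w : (forall i, w i ∈ W) -> (satW w (bFunOnNat 0 1) <-> funN E (w 0)).
Proof. intros Hw. rewrite reflects; [sem|apply Hhelp; simpl; auto|exact Hw]. Qed.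
Lemma satW_fin w : (forall i, w i ∈ W) -> (satW w (bFin 0 1) <-> fin E (w 0)).
Proof. intros Hw. rewrite reflects; [sem|apply Hhelp; simpl; auto|exact Hw]. Qed.
Lemma satW_app w : (forall i, w i ∈ W) -> (satW w (bApp 0 1 2 3) <-> app E (w 2) (w 1) (w 0)).
Proof. intros Hw. rewrite reflects; [sem|apply Hhelp; simpl; auto|exact Hw]. Qed.

Lemma nat_W k : isnat E k -> k ∈ W.
Proof.
  intros Hk. destruct (nice_ind W n _ Hnice HA) as (I & HId & HInd).
  exact (proj1 Hnice I HId k (Hk I HInd)).
Qed.

Lemma satW_star v : satW v star <-> forall F, F ∈ W -> funN E F ->
  (forall k, k ∈ W -> st k /\ isnat E k -> exists x, x ∈ W /\ app E F k x /\ st x) ->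
  exists G, G ∈ W /\ st G /\ funN E G /\
    forall k, k ∈ W -> st k /\ isnat E k -> exists x, x ∈ W /\ app E F k x /\ app E G k x.
Proof.
  assert (Kf : forall x v, x ∈ W -> (satW (x .: v) (bFunOnNat 0 1) <-> funN E x)).
  { intros x w Hx. exact (satW_fun (fun _ => x) (fun _ => Hx)). }
  assert (Kn : forall x v, x ∈ W -> (satW (x .: v) (bNat 0 1) <-> isnat E x)).
  { intros x w Hx. exact (satW_nat (fun _ => x) (fun _ => Hx)). }
  assert (Ka : forall F k x v, F ∈ W -> k ∈ W -> x ∈ W ->
    (satW (x .: k .: F .: v) (bApp 0 1 2 3) <-> app E F k x)).
  { intros F k x w HF Hk Hx. apply (satW_app (x .: k .: (fun _ => F))).
    intros [|[|i]]; simpl; assumption. }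
  unfold star. apply sat_bAll; intros F HF. apply sat_bImp; [exact (Kf F v HF)|]. apply sat_bImp.
  - apply sat_bAll; intros k Hk. apply sat_bImp; [apply sat_bAnd; [reflexivity|exact (Kn k v Hk)]|].
    apply sat_bEx; intros x Hx. apply sat_bAnd; [exact (Ka F k x v HF Hk Hx)|reflexivity].
  - apply sat_bEx; intros G HG. apply sat_bAnd; [reflexivity|]. apply sat_bAnd; [exact (Kf G v HG)|].
    apply sat_bAll; intros k Hk. apply sat_bImp; [apply sat_bAnd; [reflexivity|exact (Kn k v Hk)]|].
    apply sat_bEx; intros x Hx. apply sat_bAnd; [exact (Ka F k x v HF Hk Hx)|exact (Ka G k x v HG Hk Hx)].
Qed.

Lemma Df_satW C b f (s : (nat -> M) -> nat -> M) : C W -> (b = true -> internal f) ->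
  (forall i, isTm C (fun v => s v i)) -> Df E st C b (fun v => satW (s v) f).
Proof.
  intros HC Hf Hs. apply (Df_subst E st C b (fun v => satW v f)); [|exact Hs].
  apply Df_sat; [df|exact Hf].
Qed.

Lemma satW_stand f v : satW v (ax_stand f).
Proof.
  match goal with |- ?G => assert (K : G <-> forall X, X ∈ W -> st X -> exists Y, Y ∈ W /\ st Y /\
    forall x, x ∈ W -> st x -> (x ∈ Y <-> x ∈ X /\ satW (x .: v) f)) end.
  { sem. rewrite sat_emb.
    match goal with |- sat _ _ _ ?a _ <-> sat _ _ _ ?b _ => replace a with b; [tauto|] end.
    apply functional_extensionality; intros [|i]; simpl; rewrite ?Nat.sub_0_r; reflexivity. }
  apply K. intros X HX HsX.
  destruct (standardization (fun x => x ∈ W /\ satW (x .: v) f)) with (X := X) as (Y & HsY & HY).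
  - apply DfAnd; [df|]. apply (Df_satW _ false f (fun w => w 0 .: v)); [exact I|discriminate|].
    intros [|i]; istm.
  - exact HsX.
  - assert (HYX : sub E Y X).
    { intros z. revert z. by_transfer; [df|]. intros z Hz H. apply (HY z Hz), H. }
    exists Y. split; [exact (proj1 (proj2 Hnice) X Y HX HYX)|]. split; [exact HsY|].
    intros x Hx Hsx. rewrite (HY x Hsx). tauto.
Qed.

Lemma satW_transfer k f v : internal f -> bounded (S k) f -> (forall i, v i ∈ W) ->
  satW v (ax_transfer k f).
Proof.
  intros Hf Hbf Hv Hst HEx.
  apply sat_FEx in HEx. destruct HEx as (x & Hx & Hxf).
  assert (Hstv : forall i, i < k -> st (v i)).
  { clear - Hst. induction k as [|k IH]; intros i Hi; [lia|].
    cbn [stconj] in Hst. apply sat_FAnd in Hst. destruct Hst as [H1 H2].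
    destruct (Nat.eq_dec i k) as [->|Hik]; [exact H1|apply IH; [exact H2|lia]]. }
  set (w := fun i => if i <? k then v i else m0).
  assert (Hw : forall y, satW (y .: w) f <-> satW (y .: v) f).
  { intros y. apply sat_bounded with (S k); [exact Hbf|]. intros [|i] Hi; simpl; [reflexivity|].
    unfold w. destruct (Nat.ltb_spec i k); [reflexivity|lia]. }
  destruct (transfer (fun x => x ∈ W /\ satW (x .: w) f)) as (y & Hsy & Hy & Hyf).
  - apply DfAnd; [df|]. apply (Df_satW st true f (fun u => u 0 .: w)); [exact HW|auto|].
    intros [|i]; cbn [econs]; [istm|]. apply (TCst (w i)). unfold w.
    destruct (Nat.ltb_spec i k); auto.
  - exists x; split; [exact Hx|apply Hw, Hxf].
  - apply sat_FEx. exists y; split; [exact Hy|]. apply sat_FAnd; split; [exact Hsy|apply Hw, Hyf].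
Qed.

Lemma finite_cover A : fin E A -> st A -> exists A', st A' /\ A' ∈ W /\ fin E A' /\
  forall a, a ∈ A -> a ∈ W -> a ∈ A'.
Proof.
  intros HfA HsA.
  apply (transfer (fun A' => A' ∈ W /\ fin E A' /\ forall a, a ∈ A -> a ∈ W -> a ∈ A')); [df|].
  apply (fin_ind (fun B => exists A', A' ∈ W /\ fin E A' /\ forall a, a ∈ B -> a ∈ W -> a ∈ A')); [df| | |exact HfA].
  - intros e He. exists e. split; [apply nat_W, nat_empty, He|]. split; [apply fin_empty, He|].
    intros a Ha; destruct (He a Ha).
  - intros B x B' (A' & H1 & H2 & H3) _ HB'. destruct (classic (x ∈ W)) as [Hx|Hx].
    + destruct (insert_exists A' x) as [A2 HA2]. exists A2. split; [|split].
      * apply (nice_insert W A' x); auto. intros z; apply HA2.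
      * apply (fin_insert A' x); auto.
      * intros a Ha HaW. apply HA2. apply HB' in Ha. destruct Ha as [Ha| ->]; auto.
    + exists A'. split; [exact H1|split; [exact H2|]]. intros a Ha HaW. apply HB' in Ha.
      destruct Ha as [Ha| ->]; [auto|contradiction].
Qed.

Lemma satW_ideal f v : internal f -> satW v (ax_ideal f).
Proof.
  intros Hf.
  match goal with |- ?G => assert (K : G <->
    ((forall A, A ∈ W -> st A /\ fin E A -> exists x, x ∈ W /\ forall a, a ∈ W -> a ∈ A -> satW (x .: a .: v) f)
     <-> exists x, x ∈ W /\ forall a, a ∈ W -> st a -> satW (x .: a .: v) f)) end.
  { unfold ax_ideal; apply sat_bIff.
    - apply sat_bAll; intros A HAW. apply sat_bImp.
      + apply sat_bAnd; [reflexivity|]. exact (satW_fin (fun _ => A) (fun _ => HAW)).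
      + sem. rewrite sat_emb.
        match goal with |- sat _ _ _ ?a _ <-> sat _ _ _ ?b _ => replace a with b; [tauto|] end.
        apply functional_extensionality; intros [|[|i]]; simpl; rewrite ?Nat.sub_0_r; reflexivity.
    - sem. rewrite sat_emb.
      match goal with |- sat _ _ _ ?a _ <-> sat _ _ _ ?b _ => replace a with b; [tauto|] end.
      apply functional_extensionality; intros [|[|i]]; simpl; rewrite ?Nat.sub_0_r; reflexivity. }
  apply K. clear K.
  assert (HId := idealization (fun x a => x ∈ W /\ (a ∈ W -> satW (x .: a .: v) f))).
  destruct HId as [H1 H2].
  { apply DfAnd; [df|]. apply DfImp; [df|].
    apply (Df_satW _ true f (fun w => w 0 .: w 1 .: v)); [exact I|auto|].
    intros [|[|i]]; istm. }
  split.
  - intros H. destruct H1 as (x & Hx).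
    + intros A (HsA & HfA). destruct (finite_cover A HfA HsA) as (A' & HsA' & HA'W & HfA' & Hc).
      destruct (H A' HA'W (conj HsA' HfA')) as (x & Hx & K). exists x. intros a Ha. split; auto.
    + exists x. split; [apply (Hx m0 Hm0)|]. intros a Ha Hsa. apply Hx; assumption.
  - intros (x & Hx & Hxa) A HAW HAs. destruct H2 with (A := A) as (y & Hy); [|exact HAs|].
    + exists x. intros a Ha; split; auto.
    + destruct (classic (exists a, a ∈ A)) as [[a Ha]|Hn].
      * exists y. split; [apply (Hy a Ha)|]. intros b HbW HbA. apply Hy; assumption.
      * exists x; split; [exact Hx|]. intros a _ Ha; exfalso; eauto.
Qed.

Lemma satW_IST p : IST_ax p -> (internal p -> In p l) -> forall v, (forall i, v i ∈ W) -> satW v p.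
Proof.
  intros Hp Hin v Hv.
  destruct (classic (internal p)) as [Hi|Hi].
  - apply reflects; auto.
  - destruct Hp as [| | | | | | |f Hf|f Hf|f Hf|f|k f Hf Hbf].
    8-9: exfalso; apply Hi; simpl; intuition; apply internal_ren, Hf.
    8: apply satW_ideal, Hf.
    8: apply satW_stand.
    8: apply satW_transfer; assumption.
    all: exfalso; apply Hi; cbv; tauto.
Qed.

Lemma star_long v : (forall G, funN E G -> (forall k v, app E G k v -> v ∈ W) -> G ∈ W) -> satW v star.
Proof.
  intros HK. apply satW_star. intros F HF [[HF1 HF2] HF3] Hst.
  destruct (standardization (fun p => p ∈ F)) with (X := W) as (G & HsG & HG); [df|exact HW|].
  assert (HGW : forall p, p ∈ G -> p ∈ W).
  { by_transfer; [df|]. intros p Hp H. apply (HG p Hp), H. }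
  assert (Happ : forall a b, st a -> st b -> app E G a b -> app E F a b).
  { intros a b Ha Hb' H. apply app_op in H. apply app_op. apply (HG (op a b)), H. apply st_op; assumption. }
  assert (Hval : forall a x, st a -> st x -> app E F a x -> isnat E a -> x ∈ W -> app E G a x).
  { intros a x Ha Hx H Hn HxW. apply app_op in H. apply app_op, HG; [apply st_op; assumption|].
    split; [apply nice_op; auto using nat_W|exact H]. }
  assert (HGf : funN E G).
  { split; [split|].
    - by_transfer; [df|]. intros p Hp H. apply HF1. apply (HG p Hp), H.
    - by_transfer; [df|]. intros a Ha. by_transfer; [df|]. intros b Hb'.
      by_transfer; [df|]. intros b' Hb'' [K1 K2]. apply (HF2 a); auto.
    - by_transfer; [df|]. intros a Ha. split.
      + intros H. apply transfer in H; [|df]. destruct H as (b & Hb' & H). apply HF3. eauto.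
      + intros Hn. destruct (Hst a (nat_W a Hn) (conj Ha Hn)) as (x & Hx & H & Hsx). eauto. }
  exists G. split; [|split; [exact HsG|split; [exact HGf|]]].
  - apply HK; [exact HGf|]. intros k x Hx. apply app_op, HGW in Hx.
    assert (T := proj1 Hnice). apply (T (upair k x)); [apply (T _ Hx)|]; unfold op; apply upair_spec; auto.
  - intros k Hk [Hsk Hn]. destruct (Hst k Hk (conj Hsk Hn)) as (x & Hx & H & Hsx).
    exists x. split; [exact Hx|split; [exact H|apply Hval; assumption]].
Qed.

Lemma constant_function w : w ∈ W -> exists F, F ∈ W /\ funN E F.
Proof.
  intros Hw. destruct omega_exists as [o Ho].
  destruct (replacement (fun k p => pair E k w p)) with (A := o) as [F HF].
  - df.
  - intros k _. exists (op k w); apply pair_op; reflexivity.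
  - intros k p p' _ H1 H2. apply pair_op in H1, H2; congruence.
  - assert (App : forall k x, app E F k x <-> isnat E k /\ x = w).
    { intros k x. rewrite app_op, HF. split.
      - intros (c & Hc & Hp). apply pair_op, op_inj in Hp. destruct Hp; subst. split; [apply Ho, Hc|auto].
      - intros [Hk ->]. exists k; split; [apply Ho, Hk|apply pair_op; reflexivity]. }
    exists F. split; [|split; [split|]].
    + destruct (nice_ind W n _ Hnice HA) as (I & HIW & HInd).
      destruct (proj1 (proj2 (proj2 Hnice)) w w Hw Hw) as (Y & HY & HwY & _).
      apply (nice_graph W I Y); auto. intros p Hp. apply HF in Hp. destruct Hp as (k & Hk & Hp).
      exists k, w. split; [apply ind_nat; [exact HInd|apply Ho, Hk]|]. split; [exact HwY|apply pair_op, Hp].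
    + intros p Hp. apply HF in Hp. destruct Hp as (k & _ & Hp). eauto.
    + intros a b b' [H1 H2]. apply App in H1, H2. intuition congruence.
    + intros a. split; [intros [b H]; apply App in H; tauto|]. intros Ha; exists w; apply App; auto.
Qed.

Lemma function_update F k y : F ∈ W -> funN E F -> isnat E k -> y ∈ W ->
  exists F', F' ∈ W /\ funN E F' /\ forall a b, app E F' a b <-> (a <> k /\ app E F a b) \/ (a = k /\ b = y).
Proof.
  intros HFW [[HF1 HF2] HF3] Hk Hy.
  destruct (separation (fun p => ~ exists z, pair E k z p)) with (x := F) as [F0 HF0]; [df|].
  destruct (insert_exists F0 (op k y)) as [F' HF'].
  assert (App : forall a b, app E F' a b <-> (a <> k /\ app E F a b) \/ (a = k /\ b = y)).
  { intros a b. rewrite !app_op, HF', HF0. split.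
    - intros [[H1 H2]|H]; [left|right; apply op_inj, H]. split; [|exact H1].
      intros ->. apply H2. exists b; apply pair_op; reflexivity.
    - intros [[H1 H2]|[-> ->]]; [left|right; reflexivity]. split; [exact H2|].
      intros (z & Hz). apply pair_op, op_inj in Hz. tauto. }
  exists F'. split; [|split; [split; [split|]|exact App]].
  - apply (nice_insert W F (op k y)); auto; [apply nice_op; auto using nat_W|].
    intros z Hz. apply HF' in Hz. destruct Hz as [Hz|Hz]; [left; apply HF0, Hz|auto].
  - intros p Hp. apply HF' in Hp. destruct Hp as [Hp| ->]; [apply HF1, HF0, Hp|].
    exists k, y; apply pair_op; reflexivity.
  - intros a b b'. rewrite !App. intros [[[H1 H2]|[H1 H2]] [[H3 H4]|[H3 H4]]]; subst; eauto; tauto.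
  - intros a. rewrite <- HF3. split.
    + intros [b H]. apply App in H. destruct H as [[_ H]|[-> _]]; [eauto|apply HF3, Hk].
    + intros [b H]. destruct (classic (a = k)) as [->|Ha]; [exists y|exists b]; apply App; auto.
Qed.

Lemma star_short v g : st g -> funN E g -> (forall k v, app E g k v -> v ∈ W) -> ~ g ∈ W ->
  ~ satW v star.
Proof.
  intros Hsg [[Hg1 Hg2] Hg3] HgW Hgn Hstar. apply Hgn.
  destruct (idealization (fun F k => F ∈ W /\ funN E F /\ forall x, app E g k x -> app E F k x)) as [H _]; [df|].
  destruct H as (F & HF).
  - intros A [_ HA']. 
    assert (K : exists F, F ∈ W /\ funN E F /\ forall k, k ∈ A -> forall x, app E g k x -> app E F k x).
    { apply (fin_ind (fun B => exists F, F ∈ W /\ funN E F /\ forall k, k ∈ B -> forall x, app E g k x -> app E F k x));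
        [df| | |exact HA'].
      - intros e He. destruct (proj2 (proj2 (proj2 Hnice))) as [w Hw].
        destruct (constant_function w Hw) as (F & HF1 & HF2). exists F. split; [exact HF1|split; [exact HF2|]].
        intros k Hk; destruct (He k Hk).
      - intros B k B' (F & HFW & HF & HFg) _ HB'.
        destruct (classic (exists y, app E g k y)) as [[y Hy]|Hn].
        + destruct (function_update F k y) as (F' & HF'W & HF' & App); eauto; [apply Hg3; eauto|].
          exists F'. split; [exact HF'W|split; [exact HF'|]]. intros a Ha x Hx. apply App.
          destruct (classic (a = k)) as [->|Hak]; [right; eauto|left]. split; [exact Hak|].
          apply HB' in Ha. destruct Ha as [Ha|Ha]; [eauto|contradiction].
        + exists F. split; [exact HFW|split; [exact HF|]]. intros a Ha x Hx.
          apply HB' in Ha. destruct Ha as [Ha| ->]; [eauto|exfalso; eauto]. }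
    destruct K as (F & HFW & HF & HFg). exists F. eauto.
  - destruct (HF m0 Hm0) as (HFW & HFf & _).
    destruct (proj1 (satW_star v) Hstar F HFW HFf) as (G & HGW & HsG & HGf & HG).
    { intros k _ [Hsk Hn]. assert (Hex := Hn). apply Hg3 in Hex. apply transfer in Hex; [|df].
      destruct Hex as (x & Hsx & Hx). exists x. split; [eauto|split; [|exact Hsx]]. apply (HF k Hsk), Hx. }
    apply (proj1 (proj2 Hnice) G g HGW).
    assert (K : forall k x, app E g k x -> app E G k x).
    { by_transfer; [df|]. intros k Hsk x Hx. assert (Hn : isnat E k) by (apply Hg3; eauto).
      destruct (HG k (nat_W k Hn) (conj Hsk Hn)) as (y & _ & HyF & HyG).
      rewrite (proj2 (proj1 HFf) k x y); [exact HyG|]. split; [|exact HyF]. apply (HF k Hsk), Hx. }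
    intros p Hp. destruct (Hg1 p Hp) as (a & b & Hab). assert (L : app E G a b) by (apply K; exists p; auto).
    apply app_op in L. apply pair_op in Hab. subst; exact L.
Qed.
End LimitModel.

Lemma refl_list_internal l : (forall p, In p l -> internal p) -> internal (refl_list l).
Proof. induction l as [|p l IH]; simpl; [auto|]. intros H; split; auto. Qed.

Lemma internal_filter (l : list form) : exists l', forall p, In p l' <-> In p l /\ internal p.
Proof.
  induction l as [|q l [l' IH]]; [exists []; simpl; tauto|].
  destruct (classic (internal q)) as [H|H].
  - exists (q :: l'). intros p; simpl; rewrite IH. intuition congruence.
  - exists l'. intros p; simpl; rewrite IH. intuition congruence.
Qed.

Lemma Df_nice C b : Df E st C b (fun v => nice (v 0)).
Proof. unfold nice, trans, potent. df. Qed.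

Theorem star_not_internal Phi l : (forall p, In p l -> IST_ax p) -> internal Phi -> bounded 0 Phi ->
  ~ Prv (fun p => In p l) (FIff Phi star).
Proof.
  intros Hl HPhi Hb0 Hprv.
  destruct (internal_filter l) as [l0 Hl0].
  set (ls := Phi :: helpers ++ l0).
  assert (Hls : forall p, In p ls -> internal p).
  { intros p [<-|Hp]; [exact HPhi|]. apply in_app_or in Hp. destruct Hp as [Hp|Hp]; [|apply Hl0, Hp].
    simpl in Hp. destruct Hp as [<-|[<-|[<-|[<-|[]]]]]; cbv; tauto. }
  assert (Hh : forall p, In p helpers -> In p ls) by (intros p Hp; right; apply in_or_app; auto).
  assert (Hin : forall p, In p l -> internal p -> In p ls).
  { intros p Hp Hi. right; apply in_or_app; right; apply Hl0; auto. }
  assert (Hls' := refl_list_internal ls Hls).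
  destruct (bounded_exists (refl_list ls)) as [n Hn].
  assert (Hinf : internal (FImp ax_inf (refl_list ls))) by (split; [cbv; tauto|exact Hls']).
  assert (HN := Df_nice st true).
  assert (HAd : Df E st st true (fun v => adq (v 0) (v 0) n (FImp ax_inf (refl_list ls))))
    by (apply Df_adq; auto; apply TVar).
  set (A := fun W => adq W W n (FImp ax_inf (refl_list ls))) in *.
  assert (HAd' : Df E st st true (fun v => A (v 0))) by exact HAd.
  assert (Hiff : forall W, st W -> nice W -> A W -> forall v, (forall i, v i ∈ W) ->
    (sat0 v Phi <-> sat E st (fun x => x ∈ W) v star)).
  { intros W HsW HnW HAW v Hv.
    assert (K := soundness E st (fun x => x ∈ W) _ _ (fun p Hp => 
      satW_IST ls n W Hls Hh Hn HsW HnW HAW p (Hl p Hp)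
        (Hin p Hp)) Hprv v Hv).
    unfold FIff in K. rewrite sat_FAnd in K. destruct K as [K1 K2].
    rewrite <- (reflects ls n W Hls Hn HAW Phi (or_introl eq_refl) v Hv).
    split; [exact K1|exact K2]. }
  assert (HPv : forall v w, sat0 v Phi <-> sat0 w Phi).
  { intros v w. apply sat_bounded with 0; [exact Hb0|]. intros i Hi; lia. }
  destruct (classic (sat0 (fun _ => m0) Phi)) as [HT|HT].
  - destruct (transfer (fun W => exists g, nice W /\ A W /\ funN E g /\
      (forall k v, app E g k v -> v ∈ W) /\ ~ g ∈ W)) as (W & HsW & HW).
    + df.
    + apply short_limit, Hinf.
    + apply transfer in HW; [|df]. destruct HW as (g & Hsg & HnW & HAW & Hg1 & Hg2 & Hg3).
      destruct (proj2 (proj2 (proj2 HnW))) as [w Hw].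
      apply (star_short ls n W Hls Hh Hn HnW HAW (fun _ => w) g); auto.
      apply (Hiff W HsW HnW HAW); [auto|]. revert HT; apply HPv.
  - destruct (transfer (fun W => nice W /\ A W /\
      forall G, funN E G -> (forall k v, app E G k v -> v ∈ W) -> G ∈ W)) as (W & HsW & HnW & HAW & HK).
    + df.
    + apply long_limit, Hls'.
    + destruct (proj2 (proj2 (proj2 HnW))) as [w Hw].
      apply HT, (HPv (fun _ => w)), (Hiff W HsW HnW HAW); [auto|].
      apply (star_long ls n W Hls Hh Hn HsW HnW HAW); exact HK.
Qed.

End ZF.

Theorem theorem1 :
  Consistent IST_ax ->
  ~ (exists Φ : form, internal Φ /\ bounded 0 Φ /\ Prv IST_ax (FIff Φ star)).
Proof.
  intros HC (Phi & HPhi & Hb & Hprv).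
  destruct (completeness IST_ax HC) as (M & E & st & [x0] & HI).
  destruct (Prv_finite _ _ Hprv) as (l & Hl & Hprv').
  assert (Hst : exists m0, st m0).
  { assert (H := HI _ (ITransfer 0 (FEq 0 0) I (conj Nat.lt_0_1 Nat.lt_0_1)) (fun _ => x0)).
    assert (K : sat E st (fun _ => True) (fun _ => x0) (FEx (FAnd (FSt 0) (FEq 0 0)))).
    { apply H; [simpl; tauto|]. apply sat_FEx. exists x0; split; [exact I|reflexivity]. }
    apply sat_FEx in K. destruct K as (m & _ & K). apply sat_FAnd in K. exists m; apply K. }
  destruct Hst as [m0 Hm0].
  exact (star_not_internal E st HI m0 Hm0 Phi l Hl HPhi Hb Hprv').
Qed.
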